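(* Let $\|\cdot\|$ be a norm on $\mathbb{R}^d$ with unit ball $B$, with associated sequence of coordinate-$k$ norms $\|\cdot\|_{(k)}$ (unit balls $B_{(k)}$, unit spheres $S_{(k)}$) and sequence of dual coordinate-$k$ norms $\|\cdot\|_{(k),\star}$, $k\in\{1,\dots,d\}$, and with associated Capra coupling ¢. The conventions $\|\cdot\|_{(0),\star}=0$, $B_{(0)}=\{0\}$, $S_{(0)}=\{0\}$ and $\inf\emptyset=+\infty$ are used. (1) For any function $\varphi:\{0,1,\dots,d\}\to[-\infty,+\infty]$, we have $$(\varphi\circ\ell_0)^{¢¢'}(x)=\big((\varphi\circ\ell_0)^{¢}\big)^{\star'}\Big(\frac{x}{\|x\|}\Big),\qquad\forall x\in\mathbb{R}^d\setminus\{0\},$$ where the closed convex function $\big((\varphi\circ\ell_0)^{¢}\big)^{\star'}$ has the following expression as a Fenchel conjugate $$\big((\varphi\circ\ell_0)^{¢}\big)^{\star'}=\Big(\sup_{j\in\{0,\dots,d\}}\big[\|\cdot\|_{(j),\star}-\varphi(j)\big]\Big)^{\star'},$$ and also has the following four expressions as a Fenchel biconjugate. First, $$\big((\varphi\circ\ell_0)^{¢}\big)^{\star'}=\Big(\inf_{j\in\{0,\dots,d\}}\big[\delta_{B_{(j)}}\mathbin{\dot{+}}\varphi(j)\big]\Big)^{\star\star'};$$ hence the function $\big((\varphi\circ\ell_0)^{¢}\big)^{\star'}$ is the largest closed convex function below the integer valued function $\inf_{j\in\{0,\dots,d\}}[\delta_{B_{(j)}}\mathbin{\dot{+}}\varphi(j)]$,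 such that $x\in B_{(l)}\setminus B_{(l-1)}\mapsto\varphi(l)$ for $l\in\{1,\dots,d\}$, and $x\in B_{(0)}=\{0\}\mapsto\varphi(0)$, the function being infinite outside $B_{(d)}=B$; that is, $$\big((\varphi\circ\ell_0)^{¢}\big)^{\star'}=\Big(x\mapsto\inf\{\varphi(j): x\in B_{(j)},\ j\in\{0,\dots,d\}\}\Big)^{\star\star'}.$$ Moreover, $$\big((\varphi\circ\ell_0)^{¢}\big)^{\star'}=\Big(\inf_{j\in\{0,\dots,d\}}\big[\delta_{S_{(j)}}\mathbin{\dot{+}}\varphi(j)\big]\Big)^{\star\star'};$$ hence the function $\big((\varphi\circ\ell_0)^{¢}\big)^{\star'}$ is the largest closed convex function below the integer valued function $\inf_{j\in\{0,\dots,d\}}[\delta_{S_{(j)}}\mathbin{\dot{+}}\varphi(j)]$; that is, $$\big((\varphi\circ\ell_0)^{¢}\big)^{\star'}=\Big(x\mapsto\inf\{\varphi(j): x\in S_{(j)},\ j\in\{0,\dots,d\}\}\Big)^{\star\star'}.$$ (2) For any function $\varphi:\{0,1,\dots,d\}\to\mathbb{R}$, that is, with finite values, the function $\big((\varphi\circ\ell_0)^{¢}\big)^{\star'}$ is proper convex lower semicontinuous and has the following variational expression $$\big((\varphi\circ\ell_0)^{¢}\big)^{\star'}(x)=\min_{\substack{(\lambda_0,\lambda_1,\dots,\lambda_d)\in\Delta_{d+1}\\ x\in\sum_{j=1}^d\lambda_jB_{(j)}}}\ \sum_{j=0}^d\lambda_j\varphi(j),\qquad\forall x\in\mathbb{R}^d.$$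 (3) For any function $\varphi:\{0,1,\dots,d\}\to[0,+\infty)$, that is, with nonnegative finite values, and such that $\varphi(0)=0$, the function $\big((\varphi\circ\ell_0)^{¢}\big)^{\star'}$ is proper convex lower semicontinuous and has the following two variational expressions: for all $x\in\mathbb{R}^d$, $$\big((\varphi\circ\ell_0)^{¢}\big)^{\star'}(x)=\min_{\substack{(\lambda_0,\lambda_1,\dots,\lambda_d)\in\Delta_{d+1}\\ x\in\sum_{j=1}^d\lambda_jS_{(j)}}}\ \sum_{j=1}^d\lambda_j\varphi(j)=\min_{\substack{z^{(1)}\in\mathbb{R}^d,\dots,z^{(d)}\in\mathbb{R}^d\\ \sum_{j=1}^d\|z^{(j)}\|_{(j)}\le1\\ \sum_{j=1}^dz^{(j)}=x}}\ \sum_{j=1}^d\varphi(j)\|z^{(j)}\|_{(j)},$$ and the function $(\varphi\circ\ell_0)^{¢¢'}$ has the following variational expression: for all $x\in\mathbb{R}^d\setminus\{0\}$, $$(\varphi\circ\ell_0)^{¢¢'}(x)=\frac{1}{\|x\|}\min_{\substack{z^{(1)}\in\mathbb{R}^d,\dots,z^{(d)}\in\mathbb{R}^d\\ \sum_{j=1}^d\|z^{(j)}\|_{(j)}\le\|x\|\\ \sum_{j=1}^dz^{(j)}=x}}\ \sum_{j=1}^d\|z^{(j)}\|_{(j)}\,\varphi(j).$$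
   Context: $d\ge 1$ is an integer and $\langle\cdot,\cdot\rangle$ is the Euclidean scalar product on $\mathbb{R}^d$. For $x\in\mathbb{R}^d$, $\ell_0(x)\in\{0,\dots,d\}$ is the number of nonzero components of $x$. The unit ball of $\|\cdot\|$ is $B=\{x\in\mathbb{R}^d:\|x\|\le 1\}$. For $K\subset\{1,\dots,d\}$, $\mathcal{R}_K=\{x\in\mathbb{R}^d : x_j=0\ \forall j\notin K\}$, and for $y\in\mathbb{R}^d$, $y_K\in\mathcal{R}_K$ coincides with $y$ on the components in $K$ and is zero outside $K$. Coordinate norms: for $K\subset\{1,\dots,d\}$ and $y\in\mathcal{R}_K$, $\|y\|_{K,\star}=\sup\{\langle x,y\rangle : x\in\mathcal{R}_K,\ \|x\|\le 1\}$. The dual coordinate-$k$ norm is $\|y\|_{(k),\star}=\sup_{K\subset\{1,\dots,d\},\,|K|\le k}\|y_K\|_{K,\star}$ for $y\in\mathbb{R}^d$ (this is a norm), and the coordinate-$k$ norm is the norm whose dual norm is $\|\cdot\|_{(k),\star}$: $\|x\|_{(k)}=\sup\{\langle x,y\rangle:\|y\|_{(k),\star}\le 1\}$. For $k\in\{1,\dots,d\}$, $B_{(k)}=\{x:\|x\|_{(k)}\le1\}$ and $S_{(k)}=\{x:\|x\|_{(k)}=1\}$. Lower and upper Moreau additions $\mathbin{\underset{\cdot}{+}}$ and $\mathbin{\dot{+}}$ extend the usual addition to $[-\infty,+\infty]$ with $(+\infty)\mathbin{\underset{\cdot}{+}}(-\infty)=(-\infty)\mathbin{\underset{\cdot}{+}}(+\infty)=-\infty$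 and $(+\infty)\mathbin{\dot{+}}(-\infty)=(-\infty)\mathbin{\dot{+}}(+\infty)=+\infty$. For a set $A\subset\mathbb{R}^d$, $\delta_A$ is $0$ on $A$ and $+\infty$ outside $A$. The Capra coupling ¢ associated with $\|\cdot\|$ is $¢:\mathbb{R}^d\times\mathbb{R}^d\to\mathbb{R}$, $¢(x,y)=\langle x,y\rangle/\|x\|$ if $x\ne0$, $¢(0,y)=0$. For $f:\mathbb{R}^d\to[-\infty,+\infty]$: the ¢-conjugate is $f^{¢}(y)=\sup_{x\in\mathbb{R}^d}\big(¢(x,y)\mathbin{\underset{\cdot}{+}}(-f(x))\big)$ and the ¢-biconjugate is $f^{¢¢'}(x)=\sup_{y\in\mathbb{R}^d}\big(¢(x,y)\mathbin{\underset{\cdot}{+}}(-f^{¢}(y))\big)$. Fenchel conjugates: $f^{\star}(y)=\sup_{x\in\mathbb{R}^d}\big(\langle x,y\rangle\mathbin{\underset{\cdot}{+}}(-f(x))\big)$; for $g:\mathbb{R}^d\to[-\infty,+\infty]$, $g^{\star'}(x)=\sup_{y\in\mathbb{R}^d}\big(\langle x,y\rangle\mathbin{\underset{\cdot}{+}}(-g(y))\big)$; and $f^{\star\star'}=(f^\star)^{\star'}$. A function $\mathbb{R}^d\to[-\infty,+\infty]$ is closed if it is either lower semicontinuous and nowhere equal to $-\infty$, or the constant $-\infty$; it is convex if its epigraph is convex; it is proper if it never takes the value $-\infty$ and is not identically $+\infty$. $\Delta_{d+1}=\{(\lambda_0,\dots,\lambda_d)\in\mathbb{R}^{d+1}:\lambda_j\ge0,\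 \sum_{j=0}^d\lambda_j=1\}$ is the simplex of $\mathbb{R}^{d+1}$. Sums such as $\sum_{j=1}^d\lambda_jB_{(j)}$ are Minkowski sums.
   Formalization: In (1), the values φ(l) on B_(l)∖B_(l−1) and φ(0) at 0 fail for general φ (d=1, φ(0)=1, φ(1)=0); they are replaced by inf of φ(j) over j≥l (over all j at 0), with the original values kept for nondecreasing φ. The false ''integer valued'' is dropped. *)

(* Defs.v *)
From HB Require Import structures.
From mathcomp Require Import all_boot all_order all_algebra.
From mathcomp Require Import all_classical all_reals all_analysis.

Set Implicit Arguments.
Unset Strict Implicit.
Unset Printing Implicit Defensive.

Import Order.TTheory GRing.Theory Num.Theory.
Import numFieldNormedType.Exports.

Local Open Scope classical_set_scope.
Local Open Scope ring_scope.

(** R^d is ['rV[R]_d]; its components are indexed by ['I_d] = {0, ..., d-1}. *)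

Section ExtendedFunctions.
Context {R : realType}.

Definition delta_set (T : Type) (A : set T) (x : T) : \bar R :=
  if x \in A then 0%E else +oo%E.

Definition epigraph (T : Type) (f : T -> \bar R) : set (T * R) :=
  [set p | (f p.1 <= p.2%:E)%E].

Definition convex_efun (V : lmodType R) (f : V -> \bar R) : Prop :=
  convex_set (epigraph f : set (convex_lmodType (V * R^o)%type)).

Definition closed_efun (T : topologicalType) (f : T -> \bar R) : Prop :=
  (lower_semicontinuous f /\ forall x, f x != -oo%E) \/
  (forall x, f x = -oo%E).

Definition proper_efun (T : Type) (f : T -> \bar R) : Prop :=
  (forall x, f x != -oo%E) /\ (exists x, f x != +oo%E).

Definition largest_closed_convex_below (d : nat) (g f : 'rV[R]_d -> \bar R) :=
  [/\ closed_efun g, convex_efun g, (forall x, (g x <= f x)%E) &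
      forall h : 'rV[R]_d -> \bar R, closed_efun h -> convex_efun h ->
        (forall x, (h x <= f x)%E) -> forall x, (h x <= g x)%E].

(** [v] is the minimum of [F] over [A], with value [+oo] when [A] is empty
    and attainment required when it is not. *)
Definition is_min (T : Type) (A : set T) (F : T -> \bar R) (v : \bar R) : Prop :=
  v = ereal_inf (F @` A) /\ (A !=set0 -> exists2 a, A a & F a = v).

(** The addition of [\bar R] in [%E] sends [+oo + -oo] to [-oo], hence is the
    lower Moreau addition; the upper one is the addition in [%dE]. *)
Definition conjugate (V W : Type) (c : V -> W -> R) (f : V -> \bar R) (y : W)
    : \bar R :=
  ereal_sup [set ((c x y)%:E - f x)%E | x in [set: V]].

Definition rev_conjugate (V W : Type) (c : V -> W -> R) (g : W -> \bar R)
    (x : V) : \bar R :=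
  ereal_sup [set ((c x y)%:E - g y)%E | y in [set: W]].

Definition minkowski_sum (I : finType) (V : lmodType R) (A : I -> set V)
    : set V :=
  [set \sum_i z i | z in [set z : I -> V | forall i, A i (z i)]].

Definition scale_set (V : lmodType R) (a : R) (A : set V) : set V :=
  [set a *: x | x in A].

(** The simplex of R^n. *)
Definition simplex {n : nat} : set 'rV[R]_n :=
  [set lam | (forall j, 0 <= lam 0 j) /\ \sum_j lam 0 j = 1].

End ExtendedFunctions.

Section Capra.
Context {R : realType} {d : nat}.
Implicit Types (N : 'rV[R]_d -> R) (x y : 'rV[R]_d) (K : {set 'I_d}).

Definition is_norm N : Prop :=
  [/\ forall x y, N (x + y) <= N x + N y,
      forall (a : R) x, N (a *: x) = `|a| * N x &
      forall x, N x = 0 -> x = 0].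

Definition unit_ball N : set 'rV[R]_d := [set x | N x <= 1].

Definition scalar_prod x y : R := \sum_i x 0 i * y 0 i.

Definition nz_comps x : {set 'I_d} := finset (fun i => x 0 i != 0).

Lemma card_nz_comps_lt x : (#|nz_comps x| < d.+1)%N.
Proof. by rewrite ltnS -[leqRHS](card_ord d) max_card. Qed.

Definition l0 x : 'I_d.+1 := Ordinal (card_nz_comps_lt x).

Definition coord_subspace K : set 'rV[R]_d :=
  [set x | forall j, j \notin K -> x 0 j = 0].

Definition coord_proj K y : 'rV[R]_d :=
  \row_j (if j \in K then y 0 j else 0).

Definition dual_subnorm N K y : R :=
  sup [set scalar_prod x y | x in coord_subspace K `&` unit_ball N].

Definition dual_coord_norm N (k : nat) y : R :=
  if k is 0 then 0 else
  sup [set dual_subnorm N K (coord_proj K y)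
      | K in [set K : {set 'I_d} | (#|K| <= k)%N]].

(** Meaningful for [1 <= k <= d]; index 0 is treated separately below. *)
Definition coord_norm N (k : nat) x : R :=
  sup [set scalar_prod x y | y in [set y | dual_coord_norm N k y <= 1]].

Definition coord_ball N (k : nat) : set 'rV[R]_d :=
  if k is 0 then [set 0] else [set x | coord_norm N k x <= 1].

Definition coord_sphere N (k : nat) : set 'rV[R]_d :=
  if k is 0 then [set 0] else [set x | coord_norm N k x = 1].

Definition capra N x y : R :=
  if x == 0 then 0 else scalar_prod x y / N x.

Definition capra_conj N (f : 'rV[R]_d -> \bar R) := conjugate (capra N) f.

Definition capra_biconj N (f : 'rV[R]_d -> \bar R) :=
  rev_conjugate (capra N) (capra_conj N f).

Definition fenchel (f : 'rV[R]_d -> \bar R) := conjugate scalar_prod f.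

Definition rev_fenchel (g : 'rV[R]_d -> \bar R) := rev_conjugate scalar_prod g.

Definition fenchel_biconj (f : 'rV[R]_d -> \bar R) := rev_fenchel (fenchel f).

(** Feasible sets of the minimisation problems. The index [j : 'I_d] stands for
    [j + 1] in {1, ..., d}, and [lift ord0 j : 'I_d.+1] is the element of
    {0, ..., d} of value [j + 1]; the families [A] are indexed by {0, ..., d}. *)
Definition simplex_decomp (A : nat -> set 'rV[R]_d) x : set 'rV[R]_d.+1 :=
  simplex `&`
  [set lam | minkowski_sum
    (fun j : 'I_d => scale_set (lam 0 (lift ord0 j)) (A (lift ord0 j))) x].

Definition norm_decomp N (r : R) x : set ('I_d -> 'rV[R]_d) :=
  [set z | \sum_(j < d) coord_norm N (lift ord0 j) (z j) <= r /\ \sum_(j < d) z j = x].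

End Capra.

(* Main.v *)
Require Import Defs.
From HB Require Import structures.
From mathcomp Require Import all_boot all_order all_algebra.
From mathcomp Require Import all_classical all_reals all_analysis.
From mathcomp Require Import ring lra.

(** The dual coordinate-[j] norm is the support function of the set of points of
    the unit ball with at most [j] nonzero components, and also of the ball
    [B_(j)] and of the sphere [S_(j)]. For the first set, the points with exactly
    [j] nonzero components already give the whole supremum, because a point with
    fewer of them is a limit of such points. So the Capra conjugate of
    [phi \o l0] at [y] is the supremum over [j] of
    [dual_coord_norm N j y - phi j] (lemma [capra_conj_l0]), and the Capra
    biconjugate at [x != 0] is the reverse Fenchel conjugate [L] of this function
    at [x / N x].

    The same supremum is the Fenchel conjugate of
    [x |-> inf {phi j | x in A_j}] for each family of sets [A_j] with the dual
    coordinate norms as support functions (lemma [fenchel_inf_family]), in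
    particular for the balls and for the spheres. Hence [L] is the Fenchel
    biconjugate of these functions; that it is their largest closed convex
    minorant is the Fenchel-Moreau theorem [fenchel_biconj_id], which is proved
    from the projection onto a closed convex set. The same separation argument
    shows that the bidual of [N] is [N], so that [B_(d)] is the unit ball.

    For finite [phi], let [E] be the convex hull of the sets [B_(j) x {phi j}] in
    the product of the space with the real line. It is compact, so its lower
    boundary is a closed convex function whose values are attained minima: these
    are the minima over the decompositions of [x] in the balls. Its Fenchel
    conjugate is again the supremum over [j] of [dual_coord_norm N j y - phi j],
    so by Fenchel-Moreau it equals [L] (lemma [rev_fenchel_lower_boundary]).

    When [phi >= 0] and [phi 0 = 0], replacing the weight of each term of a
    decomposition by its coordinate norm, and moving the weight so saved to index
    0, turns a decomposition in the balls into one in the spheres without raising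
    the cost. This gives the two other minima, and rescaling the last one by
    [N x] gives the formula for the Capra biconjugate. *)

Set Implicit Arguments.
Unset Strict Implicit.
Unset Printing Implicit Defensive.

Import Order.TTheory GRing.Theory Num.Theory.
Import numFieldNormedType.Exports.

Local Open Scope classical_set_scope.
Local Open Scope ring_scope.

(** * Scalar product and continuity *)

Section ScalarProduct.
Context {R : realType} {d : nat}.
Implicit Types (x y z : 'rV[R]_d) (a : R).

Lemma scalar_prodC x y : scalar_prod x y = scalar_prod y x.
Proof. by apply: eq_bigr => i _; rewrite mulrC. Qed.

Lemma scalar_prodDl x y z :
  scalar_prod (x + y) z = scalar_prod x z + scalar_prod y z.
Proof. by rewrite -big_split; apply: eq_bigr => i _; rewrite mxE mulrDl. Qed.

Lemma scalar_prodZl a x y : scalar_prod (a *: x) y = a * scalar_prod x y.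
Proof. by rewrite mulr_sumr; apply: eq_bigr => i _; rewrite mxE mulrA. Qed.

Lemma scalar_prodDr x y z :
  scalar_prod z (x + y) = scalar_prod z x + scalar_prod z y.
Proof. by rewrite scalar_prodC scalar_prodDl !(scalar_prodC z). Qed.

Lemma scalar_prodZr a x y : scalar_prod x (a *: y) = a * scalar_prod x y.
Proof. by rewrite scalar_prodC scalar_prodZl scalar_prodC. Qed.

Lemma scalar_prodNl x y : scalar_prod (- x) y = - scalar_prod x y.
Proof. by rewrite -scaleN1r scalar_prodZl mulN1r. Qed.

Lemma scalar_prodNr x y : scalar_prod x (- y) = - scalar_prod x y.
Proof. by rewrite scalar_prodC scalar_prodNl scalar_prodC. Qed.

Lemma scalar_prodBr x y z :
  scalar_prod z (x - y) = scalar_prod z x - scalar_prod z y.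
Proof. by rewrite scalar_prodDr scalar_prodNr. Qed.

Lemma scalar_prod0l y : scalar_prod 0 y = 0.
Proof. by rewrite -(scale0r 0) scalar_prodZl mul0r. Qed.

Lemma scalar_prod0r x : scalar_prod x 0 = 0.
Proof. by rewrite scalar_prodC scalar_prod0l. Qed.

Lemma scalar_prod_suml (I : finType) (z : I -> 'rV[R]_d) y :
  scalar_prod (\sum_i z i) y = \sum_i scalar_prod (z i) y.
Proof.
elim/big_ind2 : _ => [|? ? ? ? <- <-|//]; first by rewrite scalar_prod0l.
by rewrite scalar_prodDl.
Qed.

Lemma scalar_prod_ge0 x : 0 <= scalar_prod x x.
Proof. by apply: sumr_ge0 => i _; rewrite -expr2 sqr_ge0. Qed.

Lemma sqr_coord_le_scalar_prod x i : x 0 i ^+ 2 <= scalar_prod x x.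
Proof.
rewrite /scalar_prod (bigD1 i)//= -expr2 lerDl.
by apply: sumr_ge0 => j _; rewrite -expr2 sqr_ge0.
Qed.

Lemma scalar_prod_eq0 x : scalar_prod x x = 0 -> x = 0.
Proof.
move=> x0; apply/rowP => i; rewrite mxE; apply/eqP; rewrite -sqrf_eq0 eq_le.
by rewrite sqr_ge0 andbT -x0 sqr_coord_le_scalar_prod.
Qed.

Lemma scalar_prod_delta i y : scalar_prod (delta_mx 0 i) y = y 0 i.
Proof.
rewrite /scalar_prod (bigD1 i)//= mxE !eqxx mul1r big1 ?addr0// => j ji.
by rewrite mxE eqxx (negbTE ji) mul0r.
Qed.

End ScalarProduct.

Lemma continuous_sumr (K : numFieldType) (W : normedModType K)
    (T : topologicalType) (I : finType) (F : I -> T -> W) :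
  (forall i, continuous (F i)) -> continuous (fun t => \sum_i F i t).
Proof.
move=> cF.
have cD : continuous (fun p : W * W => p.1 + p.2) by exact: add_continuous.
exact: (@continuous_big W I +%R 0 xpredT cD T (index_enum I) F (fun i _ => cF i)).
Qed.

Lemma continuous_scalar_prod (R : realType) (d : nat) (T : topologicalType)
    (f g : T -> 'rV[R]_d) :
  continuous f -> continuous g -> continuous (fun t => scalar_prod (f t) (g t)).
Proof.
move=> cf cg; apply: continuous_sumr => i t.
apply: (@continuousM _ _ (fun t => f t 0 i) (fun t => g t 0 i)).
- exact: (continuous_comp (@cf t) (@coord_continuous _ _ _ 0 i (f t))).
- exact: (continuous_comp (@cg t) (@coord_continuous _ _ _ 0 i (g t))).
Qed.

Lemma continuous_comp_fst (S T U : topologicalType) (f : S -> U) :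
  continuous f -> continuous (fun p : S * T => f p.1).
Proof. by move=> cf p; exact: (continuous_comp cvg_fst (cf p.1)). Qed.

Lemma continuous_comp_snd (S T U : topologicalType) (f : T -> U) :
  continuous f -> continuous (fun p : S * T => f p.2).
Proof. by move=> cf p; exact: (continuous_comp cvg_snd (cf p.2)). Qed.

(** * Two order facts on extended reals *)

Section ExtendedReals.
Context {R : realType}.
Implicit Types (X G : \bar R).
Local Open Scope ereal_scope.

(** The Galois connection between a function and its conjugate rests on this
    symmetry; with a real [a], lower addition never meets opposite infinities
    here, so that no finiteness of [X] or [G] has to be assumed. *)
Lemma lee_EFin_subC (a : R) X G : (a%:E - X <= G) = (a%:E - G <= X).
Proof.
move: X G => [x| |] [g| |] //=; rewrite ?addye ?addeNy ?leey ?leNye//.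
by rewrite -!EFinB !lee_fin !lerBlDr addrC.
Qed.

Lemma lee_lt_EFin X G : (forall a : R, a%:E < X -> a%:E <= G) -> X <= G.
Proof.
move=> XG; apply/lee_addgt0Pr => e e0; move: X XG => [x| |] XG; last 2 first.
- move: G XG => [g| |] XG //=; rewrite ?leey//.
  + by have := XG (g + 1)%R (ltry _); rewrite lee_fin gerDl ler10.
  + by have := XG 0%R (ltry _).
- by rewrite leNye.
- by rewrite -leeBlDr//; apply: XG; rewrite lte_fin ltrBlDr ltrDl.
Qed.

End ExtendedReals.

(** * Conjugates, closed convex functions and their epigraphs *)

Section Conjugacy.
Context {R : realType} (S T : Type) (c : S -> T -> R).
Implicit Types G : \bar R.
Local Open Scope ereal_scope.

Lemma le_conjugateP (f : S -> \bar R) (y : T) G :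
  conjugate c f y <= G <-> (forall x, (c x y)%:E - f x <= G).
Proof.
split=> [fG x|fG]; first exact: (le_trans (ereal_sup_ubound _) fG).
by apply: ge_ereal_sup => _ [x _ <-].
Qed.

Lemma le_rev_conjugateP (g : T -> \bar R) (x : S) G :
  rev_conjugate c g x <= G <-> (forall y, (c x y)%:E - g y <= G).
Proof.
split=> [gG y|gG]; first exact: (le_trans (ereal_sup_ubound _) gG).
by apply: ge_ereal_sup => _ [y _ <-].
Qed.

End Conjugacy.

Section FenchelConjugacy.
Context {R : realType} {d : nat}.
Local Notation V := 'rV[R]_d.
Implicit Types (f g h : V -> \bar R) (x y : V).
Local Open Scope ereal_scope.

Lemma le_rev_fenchelP g x G :
  rev_fenchel g x <= G <-> (forall y, (scalar_prod x y)%:E - g y <= G).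
Proof. exact: le_rev_conjugateP. Qed.

Lemma rev_fenchel_ge g x y : (scalar_prod x y)%:E - g y <= rev_fenchel g x.
Proof. exact: (iffLR (le_rev_fenchelP g x _) (lexx _)). Qed.

Lemma fenchel_ge f x y : (scalar_prod x y)%:E - f x <= fenchel f y.
Proof. exact: (iffLR (le_conjugateP _ f y _) (lexx _)). Qed.

Lemma fenchel_biconj_le f x : fenchel_biconj f x <= f x.
Proof. by apply/le_rev_fenchelP => y; rewrite lee_EFin_subC; exact: fenchel_ge. Qed.

Lemma fenchel_biconj_mono f g :
  (forall x, f x <= g x) -> forall x, fenchel_biconj f x <= fenchel_biconj g x.
Proof.
move=> fg x; apply/le_rev_fenchelP => y.
apply: le_trans (rev_fenchel_ge _ _ y); apply: leeB => //.
apply/le_conjugateP => z; apply: le_trans (fenchel_ge _ z _).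
by apply: leeB => //; exact: fg.
Qed.

End FenchelConjugacy.

Section ConvexClosed.
Context {R : realType} {d : nat}.
Local Notation V := 'rV[R]_d.
Implicit Types (f g h : V -> \bar R) (x y : V) (C : set (V * R)).

Lemma convex_efunP h : convex_efun h <->
  (forall x y r s t, 0 <= t -> t <= 1 -> (h x <= r%:E)%E -> (h y <= s%:E)%E ->
    (h (t *: x + (1 - t) *: y)%R <= (t * r + (1 - t) * s)%:E)%E).
Proof.
split=> [ch x y r s t t0 t1 hx hy|ch [x r] [y s] t].
- by have /set_mem := ch (x, r) (y, s) (Itv01 t0 t1) (mem_set hx) (mem_set hy).
- by move=> /set_mem hx /set_mem hy; apply: mem_set; exact: ch.
Qed.

Lemma scalar_prod_continuousl y : continuous (fun x : V => scalar_prod x y).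
Proof. by apply: continuous_scalar_prod; [move=> ?; exact: cvg_id|exact: cst_continuous]. Qed.

Lemma convex_rev_fenchel g : convex_efun (rev_fenchel g).
Proof.
apply/convex_efunP => x y r s t t0 t1 /le_rev_fenchelP xr /le_rev_fenchelP ys.
apply/le_rev_fenchelP => z; have := ys z; have := xr z.
rewrite scalar_prodDl !scalar_prodZl; case: (g z) => [b| |] //=;
  last by move=> _ _; rewrite leNye.
rewrite -!EFinD !lee_fin => xb yb.
have t1' : 0 <= 1 - t by rewrite subr_ge0.
rewrite [leLHS](_ : _ =
  t * (scalar_prod x z - b) + (1 - t) * (scalar_prod y z - b)); last by ring.
by rewrite lerD// ler_wpM2l.
Qed.

Lemma lsc_rev_fenchel g : lower_semicontinuous (rev_fenchel g).
Proof.
move=> x a ax; have [y ay] : exists y, (a%:E < (scalar_prod x y)%:E - g y)%E.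
  apply/not_existsP => nay; move: ax; apply/negP; rewrite -leNgt.
  by apply/le_rev_fenchelP => y; rewrite leNgt; exact/negP.
case: (g y) (rev_fenchel_ge g ^~ y) ay => [b| |] // gy ay; last first.
  by exists setT => [|z _]; [exact: filterT|exact: lt_le_trans (gy z)].
exists [set z | a + b < scalar_prod z y].
  apply: (@open_nbhs_nbhs _ x); split.
    apply: (@open_comp _ _ (scalar_prod^~ y) [set u | a + b < u]).
      by move=> z _; exact: scalar_prod_continuousl.
    exact: open_gt.
  by move: ay; rewrite -EFinB lte_fin ltrBrDr.
move=> z abz; apply: lt_le_trans (gy z).
by rewrite -EFinB lte_fin ltrBrDr.
Qed.

(** Both alternatives in the definition of a closed function occur: the
    conjugate of the constant [+oo] is the constant [-oo]. *)
Lemma closed_rev_fenchel g : closed_efun (rev_fenchel g).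
Proof.
have [goo|/existsNP[y /eqP gy]] := pselect (forall y, g y = +oo%E).
  right=> x; apply/eqP; rewrite -leeNy_eq; apply/le_rev_fenchelP => y.
  by rewrite goo.
left; split=> [|x]; first exact: lsc_rev_fenchel.
rewrite gt_eqF// (lt_le_trans _ (rev_fenchel_ge g x y))//.
by case: (g y) gy => [b| |]//; rewrite -EFinB ltNyr.
Qed.

Lemma closed_epigraph h : lower_semicontinuous h -> closed (epigraph h : set (V * R)).
Proof.
move=> lh; rewrite -[X in closed X]setCK; apply: open_closedC.
rewrite openE => -[x r] /= /negP; rewrite -ltNge => rh.
have [s rs sh] : exists2 s, r < s & (s%:E < h x)%E.
  move: rh; case: (h x) => [b| |] //.
  - by rewrite lte_fin => /midf_lt[rm mb]; exists ((r + b) / 2).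
  - by exists (r + 1); rewrite ?ltrDl ?ltry.
have [A Ax Ah] := lh x s sh.
exists (A, [set t | t < s]); first by split => //=; exact: lt_nbhsl.
move=> [y t] /= [/Ah sy ts]; apply/negP; rewrite -ltNge.
by apply: lt_trans sy; rewrite lte_fin.
Qed.

End ConvexClosed.

(** * Separation and the Fenchel-Moreau theorem *)

Section Separation.
Context {R : realType} {d : nat}.
Local Notation V := 'rV[R]_d.
Implicit Types (C : set (V * R)) (p q : V * R).

Let dist2 p q : R :=
  scalar_prod (p.1 - q.1) (p.1 - q.1) + (p.2 - q.2) ^+ 2.

Let continuous_dist2 q : continuous (dist2 ^~ q).
Proof.
have c1 : continuous (fun p : V * R => p.1 - q.1).
  move=> p; apply: (@continuousB _ _ _ fst (cst q.1));
    by [exact: cvg_fst|exact: cst_continuous].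
have c2 : continuous (fun p : V * R => p.2 - q.2).
  move=> p; apply: (@continuousB _ _ _ snd (cst q.2));
    by [exact: cvg_snd|exact: cst_continuous].
move=> p; apply: (@continuousD _ _ _ (fun p => scalar_prod (p.1 - q.1) (p.1 - q.1))
  (fun p => (p.2 - q.2) ^+ 2)).
  exact: continuous_scalar_prod.
exact: (continuous_comp (c2 p) (@exprn_continuous _ 2 _)).
Qed.

Let compact_dist2 q (M : R) : compact [set p | dist2 p q <= M].
Proof.
pose I (c : R) : set R := `[c - (M + 1), c + (M + 1)]%classic.
have inI (c t : R) : (t - c) ^+ 2 <= M -> I c t.
  move=> tM; rewrite /I/= in_itv/= -ler_distl.
  have := sqr_ge0 (`|t - c| - 1); have := normr_ge0 (t - c).
  by rewrite -(real_normK (num_real (t - c))) in tM; nra.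
have cB : compact ([set x : V | forall i, I (q.1 0 i) (x 0 i)] `*` I q.2).
  apply: compact_setX; last exact: segment_compact.
  by apply: (@rV_compact _ _ (fun i => I (q.1 0 i))) => i; exact: segment_compact.
apply: subclosed_compact cB _.
  apply: (@preimage_closed _ _ (dist2 ^~ q) [set t | t <= M]).
    by move=> p _; exact: continuous_dist2.
  exact: closed_le.
move=> p /= pM; split=> [i|]; apply: inI; apply: le_trans pM.
- have := sqr_coord_le_scalar_prod (p.1 - q.1) i; rewrite !mxE => /le_trans; apply.
  by rewrite lerDl sqr_ge0.
- by rewrite lerDr scalar_prod_ge0.
Qed.

Let nearest_point C q : closed C -> C !=set0 ->
  exists2 p, C p & forall p', C p' -> dist2 p q <= dist2 p' q.
Proof.
move=> cC [p0 Cp0]; pose K := C `&` [set p | dist2 p q <= dist2 p0 q].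
have K0 : K !=set0 by exists p0; split => /=.
have cK : compact K by rewrite /K setIC; exact: compact_closedI.
have cf : {within K, continuous (dist2 ^~ q)}.
  by apply: continuous_subspaceT => p; exact: continuous_dist2.
have [p /set_mem[Cp pM] pmin] := compact_EVT_min K0 cK cf.
exists p => // p' Cp'; have [p'M|/ltW p0p'] := leP (dist2 p' q) (dist2 p0 q).
  by apply: pmin; apply/mem_set.
exact: le_trans pM p0p'.
Qed.

(** The nearest point [p] of [C] to [q] exists by compactness, and moving from
    [p] towards another point of [C] cannot get closer to [q]: the angle at [p]
    is obtuse. All separation arguments below come from this inequality. *)
Lemma projection_obtuse C q : closed C -> C !=set0 ->
  (forall p p' (t : R), C p -> C p' -> 0 <= t -> t <= 1 ->
    C (t *: p.1 + (1 - t) *: p'.1, t * p.2 + (1 - t) * p'.2)) ->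
  exists2 p, C p & forall p', C p' ->
    scalar_prod (q.1 - p.1) (p'.1 - p.1) + (q.2 - p.2) * (p'.2 - p.2) <= 0.
Proof.
move=> cC C0 vC; have [p Cp pmin] := nearest_point q cC C0.
exists p => // p' Cp'; rewrite leNgt; apply/negP.
set S := (X in 0 < X) => S0.
pose E := dist2 p' p.
have E0 : 0 <= E by rewrite addr_ge0 ?scalar_prod_ge0 ?sqr_ge0.
have key t : 0 <= t -> t <= 1 -> 2 * t * S <= t ^+ 2 * E.
  move=> t0 t1; have := pmin _ (vC _ _ _ Cp' Cp t0 t1).
  rewrite /dist2 /=.
  have -> : t *: p'.1 + (1 - t) *: p.1 - q.1 = t *: (p'.1 - p.1) - (q.1 - p.1).
    by apply/rowP => i; rewrite !mxE; ring.
  have -> : p.1 - q.1 = - (q.1 - p.1) by rewrite opprB.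
  rewrite /S /E /dist2 !(scalar_prodDl (t *: _)) !(scalar_prodDr (t *: _)).
  rewrite !scalar_prodNl !scalar_prodNr !scalar_prodZl !scalar_prodZr.
  rewrite (scalar_prodC (p'.1 - p.1) (q.1 - p.1)).
  move: (scalar_prod (q.1 - p.1) (q.1 - p.1)) => A.
  move: (scalar_prod (q.1 - p.1) (p'.1 - p.1)) => B.
  move: (scalar_prod (p'.1 - p.1) (p'.1 - p.1)) => B'.
  lra.
have SE : 0 < S + E by rewrite ltr_pwDl.
(* a step with [t <= 1] and [t * E < 2 * S], contradicting [key] *)
pose t := S / (S + E).
have t0 : 0 < t by rewrite divr_gt0.
have t1 : t <= 1 by rewrite ler_pdivrMr// mul1r lerDl.
have := key t (ltW t0) t1; rewrite -mulrA mulrCA expr2 -mulrA ler_pM2l//.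
apply/negP; rewrite -ltNge.
have -> : t * E = S - t * S.
  by rewrite /t; field; rewrite gt_eqF.
have : 0 < t * S by rewrite mulr_gt0.
lra.
Qed.

End Separation.

Section FenchelMoreau.
Context {R : realType} {d : nat}.
Local Notation V := 'rV[R]_d.
Implicit Types (h : V -> \bar R) (x y : V).

(** Projecting a point below the graph onto the epigraph gives a separating
    hyperplane. It can only be vertical when the point lies outside the domain;
    a large multiple of it is then added to any affine minorant. *)
Lemma affine_minorant_above h x0 (a : R) :
  lower_semicontinuous h -> (forall x, h x != -oo%E) -> convex_efun h ->
  (a%:E < h x0)%E ->
  exists y (b : R), (forall x, ((scalar_prod x y - b)%:E <= h x)%E) /\
    a < scalar_prod x0 y - b.
Proof.
move=> lh hNy /convex_efunP ch ax0.
have [hoo|/existsNP[x1 /eqP hx1]] := pselect (forall x, h x = +oo%E).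
  exists 0, (- a - 1); split=> [x|]; first by rewrite hoo leey.
  by rewrite scalar_prod0r; lra.
have [r1 hx1E] : exists r1 : R, h x1 = r1%:E.
  by move: hx1 (hNy x1); case: (h x1) => // r _ _; exists r.
pose C := epigraph h : set (V * R).
have C0 : C !=set0 by exists (x1, r1); rewrite /C/epigraph/= hx1E.
have cC : closed C by exact: closed_epigraph.
have vC p p' (t : R) : C p -> C p' -> 0 <= t -> t <= 1 ->
    C (t *: p.1 + (1 - t) *: p'.1, t * p.2 + (1 - t) * p'.2).
  by move=> Cp Cp' t0 t1; exact: ch.
have sep x (s : R) : (s%:E < h x)%E -> exists (z u : V) (r c : R),
    [/\ c <= 0, (forall x' r', (h x' <= r'%:E)%E ->
         scalar_prod u (x' - z) + c * (r' - r) <= 0), u = x - z, c = s - r &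
         ~ (u = 0 /\ c = 0)].
  move=> sx; have [[z r] Cz /= zP] := projection_obtuse (x, s) cC C0 vC.
  exists z, (x - z), r, (s - r); split => //.
  - have /= := zP (z, r + 1); rewrite subrr scalar_prod0r add0r.
    have -> : r + 1 - r = 1 by ring.
    rewrite mulr1; apply; rewrite /C/epigraph/=.
    by apply: le_trans Cz _; rewrite lee_fin/= lerDl.
  - by move=> x' r' hx'; exact: (zP (x', r')).
  - move=> [/eqP + /eqP]; rewrite !subr_eq0 => /eqP xz /eqP sr.
    by move: Cz; rewrite /C/epigraph/= -xz -sr leNgt sx.
(* a hyperplane that is not vertical is a graph: divide by [- c] *)
have nonvert x (s : R) (z u : V) (r c : R) : c < 0 ->
    (forall x' r', (h x' <= r'%:E)%E -> scalar_prod u (x' - z) + c * (r' - r) <= 0) ->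
    u = x - z -> c = s - r ->
    exists y (b : R), (forall x, ((scalar_prod x y - b)%:E <= h x)%E) /\
      s < scalar_prod x y - b.
  move=> c0 sP ux cs; exists ((- c)^-1 *: u), (scalar_prod z ((- c)^-1 *: u) - r).
  have c0' : 0 < (- c)^-1 by rewrite invr_gt0 oppr_gt0.
  have cc : (- c)^-1 * - c = 1 by rewrite mulVf// oppr_eq0 lt_eqF.
  split=> [x'|].
  - case E : (h x') (hNy x') => [r'| |] // _; last by rewrite leey.
    rewrite lee_fin; have := sP x' r'; rewrite E => /(_ (lexx _)).
    rewrite scalar_prodBr (scalar_prodC u) (scalar_prodC u) !scalar_prodZr => H.
    have := ler_wpM2l (ltW c0') H.
    have -> : c * (r' - r) = - c * (r - r') by ring.
    by rewrite mulrDr (mulrA _ (- c)) cc; lra.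
  - rewrite !scalar_prodZr.
    have -> : x = z + u by rewrite ux addrC subrK.
    rewrite scalar_prodDl mulrDr.
    have : 0 <= (- c)^-1 * scalar_prod u u by rewrite mulr_ge0 ?scalar_prod_ge0// ltW.
    lra.
have [z [u [r [c [c0 sP uE cE nz]]]]] := sep x0 a ax0.
have [c_eq0|cn0] := eqVneq c 0; last first.
  by apply: (nonvert x0 a z u r c) => //; rewrite lt_neqAle cn0.
(* below a point [x1] of the domain the hyperplane cannot be vertical: the
   inequality at [(x1, r1)] would read [|x1 - z1|^2 <= 0] *)
have [y1 [b1 [minor _]]] : exists y (b : R),
    (forall x, ((scalar_prod x y - b)%:E <= h x)%E) /\
    r1 - 1 < scalar_prod x1 y - b.
  have lt1 : ((r1 - 1)%:E < h x1)%E by rewrite hx1E lte_fin; lra.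
  have [z1 [u1 [s1 [c1 [c10 sP1 u1E c1E nz1]]]]] := sep _ _ lt1.
  apply: (nonvert x1 _ z1 u1 s1 c1) => //; rewrite lt_neqAle c10 andbT.
  apply/eqP => c1_eq0; have := sP1 x1 r1; rewrite hx1E => /(_ (lexx _)).
  rewrite c1_eq0 mul0r addr0 -u1E => uu; apply: nz1; split => //.
  by apply: scalar_prod_eq0; apply/eqP; rewrite eq_le uu scalar_prod_ge0.
have uu0 : 0 < scalar_prod u u.
  rewrite lt_neqAle scalar_prod_ge0 andbT eq_sym; apply/eqP => /scalar_prod_eq0 u0.
  exact: nz.
(* the multiple of the vertical hyperplane that lifts the minorant above [a] *)
pose g := (`|a - (scalar_prod x0 y1 - b1)| + 1) / scalar_prod u u.
have g0 : 0 <= g by rewrite divr_ge0 ?ltW// addr_ge0.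
exists (y1 + g *: u), (b1 + g * scalar_prod z u); split=> [x|].
- case E : (h x) (hNy x) => [r'| |] // _; last by rewrite leey.
  have := minor x; rewrite E !lee_fin => Hm.
  have := sP x r'; rewrite E => /(_ (lexx _)).
  rewrite c_eq0 mul0r addr0 scalar_prodBr (scalar_prodC u) (scalar_prodC u) => H.
  rewrite scalar_prodDr scalar_prodZr.
  have := ler_wpM2l g0 H; lra.
- rewrite scalar_prodDr scalar_prodZr.
  have -> : scalar_prod x0 u = scalar_prod z u + scalar_prod u u.
    by rewrite -scalar_prodDl [X in scalar_prod X u = _](_ : _ = z + u)// uE addrC subrK.
  have : g * scalar_prod u u = `|a - (scalar_prod x0 y1 - b1)| + 1.
    by rewrite /g divfK// gt_eqF.
  have := ler_norm (a - (scalar_prod x0 y1 - b1)).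
  rewrite mulrDr; lra.
Qed.

(** The Fenchel-Moreau theorem: each level below [h x] is exceeded by an affine
    minorant of [h], and the biconjugate lies above all of these. *)
Lemma fenchel_biconj_id h : closed_efun h -> convex_efun h ->
  fenchel_biconj h = h.
Proof.
move=> [[lh hNy]|hNy] ch; apply/funext => x; apply/eqP; rewrite eq_le fenchel_biconj_le /=.
  apply: lee_lt_EFin => a /(affine_minorant_above lh hNy ch)[y [b [minor ab]]].
  apply: le_trans (rev_fenchel_ge _ _ y).
  have hb : (fenchel h y <= b%:E)%E.
    apply/le_conjugateP => x'; rewrite lee_EFin_subC -EFinB; exact: minor.
  apply: (@le_trans _ _ ((scalar_prod x y)%:E - b%:E)%E); last exact: leeB.
  by rewrite -EFinB lee_fin ltW.
by rewrite hNy leNye.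
Qed.

End FenchelMoreau.

(** * Norms on a finite-dimensional space *)

Lemma normr_coord_le (R : realType) (d : nat) (x : 'rV[R]_d) i : `|x 0 i| <= `|x|.
Proof.
rewrite [leRHS]/Num.norm/= mx_normrE.
exact: (le_bigmax _ (fun ij : 'I_1 * 'I_d => `|x ij.1 ij.2|) (0, i)).
Qed.

Section Norm.
Context {R : realType} {d : nat} (N : 'rV[R]_d -> R) (normN : is_norm N).
Implicit Types (x y : 'rV[R]_d).

Let NZ a x : N (a *: x) = `|a| * N x. Proof. by case: normN. Qed.

Let ND x y : N (x + y) <= N x + N y. Proof. by case: normN. Qed.

Lemma is_norm0 : N 0 = 0.
Proof. by rewrite -(scale0r 0) NZ normr0 mul0r. Qed.

Lemma is_normN x : N (- x) = N x.
Proof. by rewrite -scaleN1r NZ normrN1 mul1r. Qed.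

Lemma is_norm_ge0 x : 0 <= N x.
Proof. by have := ND x (- x); rewrite subrr is_norm0 is_normN; lra. Qed.

Lemma is_norm_gt0 x : x != 0 -> 0 < N x.
Proof.
rewrite lt_neqAle is_norm_ge0 andbT eq_sym; apply: contra => /eqP.
by case: normN => _ _ N0 /esym/N0 ->.
Qed.

Lemma is_norm_le_norm : exists2 C, 0 <= C & forall x, N x <= C * `|x|.
Proof.
exists (\sum_i N (delta_mx 0 i)) => [|x].
  by apply: sumr_ge0 => i _; exact: is_norm_ge0.
rewrite [X in N X](row_sum_delta x) mulr_suml.
apply: le_trans (_ : \sum_i N (x 0 i *: delta_mx 0 i) <= _).
  elim/big_ind2 : _ => [|a u b v ua vb|//]; first by rewrite is_norm0.
  by apply: le_trans (ND _ _) _; exact: lerD.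
apply: ler_sum => i _; rewrite NZ mulrC ler_wpM2l ?is_norm_ge0//.
exact: normr_coord_le.
Qed.

Lemma is_norm_continuous : continuous N.
Proof.
have [C C0 NC] := is_norm_le_norm.
move=> x; apply/(@cvgrPdist_le _ _ _ (nbhs x)) => e e0.
have C1 : 0 < C + 1 by lra.
have eC : 0 < e / (C + 1) by rewrite divr_gt0.
apply: filterS (nbhsx_ballx x _ eC) => y; rewrite -ball_normE /ball_/= => xy.
have NB : `|N x - N y| <= N (x - y).
  rewrite ler_norml; have := ND (x - y) y; have := ND (y - x) x.
  by rewrite !subrK -(is_normN (y - x)) opprB; lra.
apply: le_trans NB _; apply: le_trans (NC _) _; move: xy.
rewrite ltr_pdivlMr//; have := normr_ge0 (x - y); nra.
Qed.

(** On the compact unit sphere of the sup norm, [N] has a positive minimum. *)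
Lemma norm_le_is_norm : exists2 C, 0 <= C & forall x, `|x| <= C * N x.
Proof.
pose S := [set x : 'rV[R]_d | `|x| = 1].
have [S0|nS] := pselect (S !=set0); last first.
  exists 0 => // x; have [->|x0] := eqVneq x 0; first by rewrite normr0 mul0r.
  by case: nS; exists (`|x|^-1 *: x); rewrite /S/= normrZ normfV normr_id mulVf// normr_eq0.
have cS : compact S.
  apply: bounded_closed_compact.
    by exists 1; split => // M M1 x /= ->; exact: ltW.
  apply: (@preimage_closed _ _ (@Num.norm _ 'rV[R]_d) [set 1]) => [x _|].
    exact: norm_continuous.
  exact: closed_eq.
have cN : {within S, continuous N}.
  by apply: continuous_subspaceT => x; exact: is_norm_continuous.
have [x0 /set_mem Sx0 minN] := compact_EVT_min S0 cS cN.
have Nx0 : 0 < N x0.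
  by apply: is_norm_gt0; rewrite -normr_gt0 Sx0.
exists (N x0)^-1 => [|x]; first by rewrite invr_ge0 ltW.
have [->|x_neq0] := eqVneq x 0.
  by rewrite normr0 is_norm0 mulr0.
rewrite ler_pdivlMl// mulrC -ler_pdivlMl ?normr_gt0//.
have -> : `|x|^-1 * N x = N (`|x|^-1 *: x) by rewrite NZ normfV normr_id.
by apply: minN; rewrite inE /S/= normrZ normfV normr_id mulVf// normr_eq0.
Qed.

End Norm.

Lemma le0_of_scale_bound (R : realType) (p b : R) :
  (forall t, 0 < t -> t * p <= b) -> p <= 0.
Proof.
move=> tpb; rewrite leNgt; apply/negP => p0.
have := tpb ((`|b| + 1) / p); rewrite divr_gt0// ?addr_ge0// => /(_ _).
rewrite divfK ?gt_eqF// => /(_ isT).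
have := ler_norm b; lra.
Qed.

(** * Coordinate norms and their duals *)

Section CoordinateNorms.
Context {R : realType} {d : nat} (N : 'rV[R]_d -> R) (normN : is_norm N).
Implicit Types (x y u : 'rV[R]_d) (k : nat) (c : R).

Let NZ a x : N (a *: x) = `|a| * N x. Proof. by case: normN. Qed.

(** The set whose support function is the dual coordinate-[k] norm, and whose
    closed convex hull is the coordinate-[k] ball. *)
Definition sparse_ball k : set 'rV[R]_d :=
  [set u | (#|nz_comps u| <= k)%N /\ N u <= 1].

Lemma nz_comps0 : nz_comps (0 : 'rV[R]_d) = finset.set0.
Proof. by apply/setP => i; rewrite !inE mxE eqxx. Qed.

Lemma nz_compsZ a x : a != 0 -> nz_comps (a *: x) = nz_comps x.
Proof. by move=> a0; apply/setP => i; rewrite !inE mxE mulf_eq0 negb_or a0. Qed.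

Lemma nz_compsN x : nz_comps (- x) = nz_comps x.
Proof. by rewrite -scaleN1r nz_compsZ// oppr_eq0 oner_eq0. Qed.

Lemma nz_comps_eq0 x : #|nz_comps x| = 0 -> x = 0.
Proof.
move/eqP; rewrite cards_eq0 => /eqP x0; apply/rowP => i; rewrite mxE.
by apply/eqP; have := finset.in_set0 i; rewrite -x0 inE => /negbFE.
Qed.

Lemma sparse_ball0 k : sparse_ball k 0.
Proof. by split; rewrite ?nz_comps0 ?cards0// is_norm0. Qed.

Let bound y : exists M, forall x, N x <= 1 -> scalar_prod x y <= M.
Proof.
have [C C0 NC] := norm_le_is_norm normN.
exists (\sum_i C * `|y 0 i|) => x Nx; apply: ler_sum => i _.
apply: le_trans (ler_norm _) _; rewrite normrM ler_wpM2r//.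
apply: le_trans (normr_coord_le _ _) _; apply: le_trans (NC x) _.
by rewrite -[leRHS]mulr1 ler_wpM2l.
Qed.

Lemma scalar_prod_coord_proj (K : {set 'I_d}) x y :
  coord_subspace K x -> scalar_prod x (coord_proj K y) = scalar_prod x y.
Proof.
move=> Kx; apply: eq_bigr => i _; rewrite mxE; case: ifPn => // /Kx ->.
by rewrite !mul0r.
Qed.

(** This lemma and [dual_coord_norm_le] say that the dual coordinate-[k] norm is
    the support function of the sparse ball. This also holds for [k = 0], which
    lets the later arguments treat all indices at once. *)
Lemma dual_coord_norm_ub k y u :
  sparse_ball k u -> scalar_prod u y <= dual_coord_norm N k y.
Proof.
case: k => [|k] [uk Nu] /=.
  by rewrite (nz_comps_eq0 (x := u)) ?scalar_prod0l//; apply/eqP; rewrite -leqn0.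
have [M yM] := bound y.
have subM (K : {set 'I_d}) : ubound [set scalar_prod x (coord_proj K y)
    | x in coord_subspace K `&` unit_ball N] M.
  by move=> _ [x [Kx Nx] <-]; rewrite scalar_prod_coord_proj//; exact: yM.
have Ku : coord_subspace (nz_comps u) u.
  by move=> j; rewrite inE negbK => /eqP.
apply: (@le_trans _ _ (dual_subnorm N (nz_comps u) (coord_proj (nz_comps u) y))).
  rewrite -(scalar_prod_coord_proj y Ku).
  by apply: ub_le_sup; [exists M; exact: subM|exists u].
apply: ub_le_sup; last by exists (nz_comps u).
exists M => _ [K _ <-]; apply: ge_sup; last exact: subM.
by exists (scalar_prod 0 (coord_proj K y)); exists 0 => //; split => [j _|];
  rewrite ?mxE// /unit_ball/= is_norm0.
Qed.

Lemma dual_coord_norm_le k y c :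
  (forall u, sparse_ball k u -> scalar_prod u y <= c) -> dual_coord_norm N k y <= c.
Proof.
case: k => [|k] uc /=.
  by have := uc 0 (sparse_ball0 0); rewrite scalar_prod0l.
have s0 (K : {set 'I_d}) : (coord_subspace K `&` unit_ball N) 0.
  by split => [j _|]; rewrite ?mxE// /unit_ball/= is_norm0.
apply: ge_sup.
  exists (dual_subnorm N finset.set0 (coord_proj finset.set0 y)), finset.set0 => //=.
  by rewrite cards0.
move=> _ [K Kk <-]; apply: ge_sup.
  by exists (scalar_prod 0 (coord_proj K y)), 0.
move=> _ [x [Kx Nx] <-]; rewrite scalar_prod_coord_proj//; apply: uc; split => //.
apply: leq_trans Kk; apply: subset_leq_card; apply/fintype.subsetP => i; rewrite inE.
by apply: contraR => /Kx ->.
Qed.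

Lemma dual_coord_norm_ge0 k y : 0 <= dual_coord_norm N k y.
Proof. by rewrite -(scalar_prod0l y) dual_coord_norm_ub//; exact: sparse_ball0. Qed.

Lemma dual_coord_norm_mono j k y :
  (j <= k)%N -> dual_coord_norm N j y <= dual_coord_norm N k y.
Proof.
move=> jk; apply: dual_coord_norm_le => u [uj Nu]; apply: dual_coord_norm_ub.
by split => //; exact: leq_trans jk.
Qed.

Lemma dual_coord_normZ_le k a y : 0 <= a ->
  dual_coord_norm N k (a *: y) <= a * dual_coord_norm N k y.
Proof.
move=> a0; apply: dual_coord_norm_le => u Uu.
by rewrite scalar_prodZr ler_wpM2l// dual_coord_norm_ub.
Qed.

Lemma dual_coord_normN_le k y :
  dual_coord_norm N k (- y) <= dual_coord_norm N k y.
Proof.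
apply: dual_coord_norm_le => u [uk Nu]; rewrite scalar_prodNr -scalar_prodNl.
by apply: dual_coord_norm_ub; split; rewrite ?nz_compsN// is_normN.
Qed.

(** For [k > 0] the sparse ball contains the normalized basis vectors and their
    opposites; this makes the dual coordinate-[k] norm definite and the supremum
    that defines the coordinate-[k] norm finite. *)
Lemma coord_le_dual_coord_norm k y i : (0 < k)%N ->
  `|y 0 i| <= N (delta_mx 0 i) * dual_coord_norm N k y.
Proof.
move=> k0; pose e : 'rV[R]_d := delta_mx 0 i.
have Ne : 0 < N e.
  apply: is_norm_gt0 => //; apply/eqP => /rowP/(_ i)/eqP.
  by rewrite !mxE !eqxx oner_eq0.
have Ue (s : R) : `|s| = 1 -> sparse_ball k ((s / N e) *: e).
  move=> s1; split.
    rewrite nz_compsZ; last first.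
      by rewrite mulf_neq0 ?invr_eq0 ?(gt_eqF Ne)// -normr_eq0 s1 oner_eq0.
    apply: leq_trans k0; rewrite -(cards1 i); apply: subset_leq_card.
    apply/fintype.subsetP => j; rewrite !inE mxE eqxx /=.
    by case: (j == i); rewrite ?eqxx.
  by rewrite NZ normrM s1 mul1r normfV (gtr0_norm Ne) mulVf// gt_eqF.
have H s : `|s| = 1 -> s * y 0 i <= N e * dual_coord_norm N k y.
  move=> s1; have := dual_coord_norm_ub y (Ue s s1); rewrite scalar_prodZl scalar_prod_delta.
  by rewrite mulrAC ler_pdivrMr// [leRHS]mulrC.
rewrite ler_norml; have := H 1 (normr1 _); have := H (-1) (normrN1 _).
by rewrite -/e => H1 H2; apply/andP; split; lra.
Qed.

Lemma dual_coord_norm_eq0 k y : (0 < k)%N -> dual_coord_norm N k y = 0 -> y = 0.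
Proof.
move=> k0 y0; apply/rowP => i; rewrite mxE; apply/eqP; rewrite -normr_eq0 eq_le.
by rewrite normr_ge0 andbT; have := coord_le_dual_coord_norm y i k0; rewrite y0 mulr0.
Qed.

Lemma coord_norm_ub k x y : (0 < k)%N -> dual_coord_norm N k y <= 1 ->
  scalar_prod x y <= coord_norm N k x.
Proof.
move=> k0 y1; apply: ub_le_sup; last by exists y.
exists (\sum_i `|x 0 i| * N (delta_mx 0 i)) => _ [z /= z1 <-].
apply: ler_sum => i _; apply: le_trans (ler_norm _) _; rewrite normrM ler_wpM2l//.
apply: le_trans (coord_le_dual_coord_norm z i k0) _.
by rewrite -[leRHS]mulr1 ler_wpM2l// is_norm_ge0.
Qed.

(** The polar form of the inequality; the vector space properties of the
    coordinate norm are all read off it. *)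
Lemma coord_norm_leP k x c : (0 < k)%N -> 0 <= c ->
  coord_norm N k x <= c <-> (forall y, scalar_prod x y <= c * dual_coord_norm N k y).
Proof.
move=> k0 c0; split=> [xc y|xc].
- have [/(dual_coord_norm_eq0 k0) ->|y0] := eqVneq (dual_coord_norm N k y) 0.
    by rewrite scalar_prod0r mulr_ge0// dual_coord_norm_ge0.
  set D := dual_coord_norm N k y in y0 *.
  have D0 : 0 < D by rewrite lt_neqAle eq_sym y0 dual_coord_norm_ge0.
  rewrite -ler_pdivrMr// mulrC -scalar_prodZr; apply: le_trans xc.
  apply: coord_norm_ub => //; rewrite -(mulVf y0).
  by apply: dual_coord_normZ_le; rewrite invr_ge0 ltW.
- apply: ge_sup => [|_ [y /= y1 <-]].
    exists (scalar_prod x 0), 0 => //=; apply: dual_coord_norm_le => u _.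
    by rewrite scalar_prod0r.
  by apply: le_trans (xc y) _; rewrite -[leRHS]mulr1 ler_wpM2l.
Qed.

Lemma coord_norm_ge0 k x : (0 < k)%N -> 0 <= coord_norm N k x.
Proof.
move=> k0; rewrite -(scalar_prod0r x); apply: coord_norm_ub => //.
by apply: dual_coord_norm_le => u _; rewrite scalar_prod0r.
Qed.

Lemma scalar_prod_le_coord_norm k x y : (0 < k)%N ->
  scalar_prod x y <= coord_norm N k x * dual_coord_norm N k y.
Proof.
by move=> k0; apply: (iffLR (coord_norm_leP x k0 _)); rewrite ?coord_norm_ge0.
Qed.

Lemma coord_norm_eq0 k x : (0 < k)%N -> coord_norm N k x = 0 -> x = 0.
Proof.
move=> k0 x0; apply: scalar_prod_eq0; apply/eqP; rewrite eq_le scalar_prod_ge0.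
by have := scalar_prod_le_coord_norm x x k0; rewrite x0 mul0r => ->.
Qed.

Lemma coord_norm0 k : (0 < k)%N -> coord_norm N k 0 = 0.
Proof.
move=> k0; apply/eqP; rewrite eq_le coord_norm_ge0// andbT.
by apply/coord_norm_leP => // y; rewrite scalar_prod0l mul0r.
Qed.

Lemma coord_normZ k a x : (0 < k)%N -> 0 <= a ->
  coord_norm N k (a *: x) = a * coord_norm N k x.
Proof.
move=> k0; have le b z : 0 <= b -> coord_norm N k (b *: z) <= b * coord_norm N k z.
  move=> b0; apply/coord_norm_leP => // [|y]; first by rewrite mulr_ge0 ?coord_norm_ge0.
  by rewrite scalar_prodZl -mulrA ler_wpM2l// scalar_prod_le_coord_norm.
rewrite le_eqVlt => /orP[/eqP <-|a0].
  by rewrite scale0r mul0r coord_norm0.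
apply/eqP; rewrite eq_le; apply/andP; split; first exact/le/ltW.
rewrite -ler_pdivlMl// -[in leLHS](scalerK (lt0r_neq0 a0) x).
by rewrite le// invr_ge0 ltW.
Qed.

Lemma coord_normN k x : (0 < k)%N -> coord_norm N k (- x) = coord_norm N k x.
Proof.
move=> k0; suff le z : coord_norm N k (- z) <= coord_norm N k z.
  by apply/eqP; rewrite eq_le le/= -[in leLHS](opprK x) le.
apply/coord_norm_leP => // [|y]; first exact: coord_norm_ge0.
rewrite scalar_prodNl -scalar_prodNr.
apply: le_trans (scalar_prod_le_coord_norm _ _ k0) _.
by rewrite ler_wpM2l ?coord_norm_ge0// dual_coord_normN_le.
Qed.

Lemma coord_ballE k : (0 < k)%N -> coord_ball N k = [set x | coord_norm N k x <= 1].
Proof. by case: k. Qed.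

(** Linear inequalities describe the scaled ball even where the scaling
    degenerates: for [c = 0] or [k = 0] they force [x = 0]. *)
Lemma scale_coord_ballP k c x : 0 <= c ->
  scale_set c (coord_ball N k) x <->
  (forall y, scalar_prod x y <= c * dual_coord_norm N k y).
Proof.
move=> c0; split=> [[b Bb <-] y|xc].
- rewrite scalar_prodZl ler_wpM2l//; case: k Bb => [->|k Bb].
    by rewrite scalar_prod0l.
  by rewrite -[leRHS]mul1r; apply: (iffLR (coord_norm_leP b (ltn0Sn k) ler01)).
- have x0 : (c == 0) || (k == 0%N) -> x = 0.
    move=> ck; apply: scalar_prod_eq0; apply/eqP; rewrite eq_le scalar_prod_ge0 andbT.
    apply: le_trans (xc x) _; case/orP: ck => /eqP ->; rewrite ?mul0r//=.
    by rewrite mulr0.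
  case: k xc x0 => [|k] xc x0.
    by exists 0; rewrite // x0 ?orbT// scaler0.
  have [c_eq0|c_neq0] := eqVneq c 0.
    exists 0; last by rewrite scaler0 x0// c_eq0 eqxx.
    by rewrite /coord_ball/= coord_norm0.
  exists (c^-1 *: x); last by rewrite scalerA divff// scale1r.
  rewrite /coord_ball/= coord_normZ ?invr_ge0// ler_pdivrMl ?mulr1; last first.
    by rewrite lt_neqAle eq_sym c_neq0.
  exact/coord_norm_leP.
Qed.

Lemma coord_ballP k x :
  coord_ball N k x <-> (forall y, scalar_prod x y <= dual_coord_norm N k y).
Proof.
have -> : coord_ball N k x = scale_set 1 (coord_ball N k) x.
  apply/propext; split=> [Bx|[b Bb <-]]; first by exists x => //; rewrite scale1r.
  by rewrite scale1r.
split=> [/(scale_coord_ballP _ _ ler01) H y|H]; first by rewrite -[leRHS]mul1r.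
by apply/scale_coord_ballP => // y; rewrite mul1r.
Qed.

Lemma scale_coord_ball_le k c x : (0 < k)%N -> 0 <= c ->
  scale_set c (coord_ball N k) x <-> coord_norm N k x <= c.
Proof.
move=> k0 c0; split=> [/(scale_coord_ballP _ _ c0) H|H]; first exact/coord_norm_leP.
by apply/scale_coord_ballP => //; exact/coord_norm_leP.
Qed.

Lemma coord_ball0 k : coord_ball N k 0.
Proof. by apply/coord_ballP => y; rewrite scalar_prod0l dual_coord_norm_ge0. Qed.

Lemma coord_ball_mono j k : (j <= k)%N -> coord_ball N j `<=` coord_ball N k.
Proof.
move=> jk x /coord_ballP Bx; apply/coord_ballP => y.
exact: le_trans (Bx y) (dual_coord_norm_mono y jk).
Qed.

Lemma coord_sphere_sub_ball k : coord_sphere N k `<=` coord_ball N k.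
Proof. by case: k => [|k] x //=; rewrite /coord_sphere/= => ->. Qed.

Lemma dual_coord_norm_le_ball k y c :
  (forall x, coord_ball N k x -> scalar_prod x y <= c) -> dual_coord_norm N k y <= c.
Proof.
move=> xc; apply: dual_coord_norm_le => u Uu; apply: xc.
by apply/coord_ballP => z; exact: dual_coord_norm_ub.
Qed.

Lemma coord_sphere_normalize k x : (0 < k)%N -> x != 0 ->
  coord_sphere N k ((coord_norm N k x)^-1 *: x).
Proof.
case: k => // k _ x0; have n0 : coord_norm N k.+1 x != 0.
  by apply: contraNneq x0 => /coord_norm_eq0 ->.
by rewrite /coord_sphere/= coord_normZ ?invr_ge0 ?coord_norm_ge0// mulVf.
Qed.

Lemma coord_sphere_neq0 k : (0 < d)%N -> coord_sphere N k !=set0.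
Proof.
case: k => [|k] d0; first by exists 0.
pose e : 'rV[R]_d := delta_mx 0 (Ordinal d0).
exists ((coord_norm N k.+1 e)^-1 *: e); apply: coord_sphere_normalize => //.
by apply/eqP => /rowP/(_ (Ordinal d0))/eqP; rewrite !mxE !eqxx oner_eq0.
Qed.

(** A point of the ball is a multiple of a point of the sphere by a factor between
    0 and 1, so the bound passes to it once [c >= 0]; and [c >= 0] because the
    sphere is symmetric and nonempty. *)
Lemma dual_coord_norm_le_sphere k y c : (0 < d)%N ->
  (forall x, coord_sphere N k x -> scalar_prod x y <= c) ->
  dual_coord_norm N k y <= c.
Proof.
case: k => [|k] d0 xc; first by have := xc 0 erefl; rewrite scalar_prod0l.
have c0 : 0 <= c.
  have [s Ss] := coord_sphere_neq0 k.+1 d0.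
  have := xc (- s); rewrite scalar_prodNl /coord_sphere/= coord_normN// => /(_ Ss).
  by have := xc s Ss; lra.
apply: dual_coord_norm_le_ball => x Bx.
have [->|x0] := eqVneq x 0; first by rewrite scalar_prod0l.
have := xc _ (coord_sphere_normalize (ltn0Sn k) x0); rewrite scalar_prodZl.
have n0 : 0 < coord_norm N k.+1 x.
  rewrite lt_neqAle coord_norm_ge0// andbT eq_sym.
  by apply: contraNneq x0 => /coord_norm_eq0 ->.
rewrite ler_pdivrMl// => H; apply: le_trans H _.
by rewrite -[leRHS]mul1r ler_wpM2r.
Qed.

(** The bidual of [N] is [N]: by homogeneity, the linear part of an affine
    minorant of [N] has dual norm at most 1, so it takes part in the supremum
    that defines the coordinate norm. *)
Lemma coord_norm_full x : (0 < d)%N -> coord_norm N d x = N x.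
Proof.
move=> d0; apply/eqP; rewrite eq_le; apply/andP; split.
  apply/coord_norm_leP => // [|y]; first exact: is_norm_ge0.
  have [->|x0] := eqVneq x 0.
    rewrite scalar_prod0l mulr_ge0 ?dual_coord_norm_ge0//.
    exact: is_norm_ge0.
  have Nx := is_norm_gt0 normN x0.
  rewrite -ler_pdivrMl// -scalar_prodZl; apply: dual_coord_norm_ub; split.
    by rewrite -[leqRHS](card_ord d) max_card.
  by rewrite NZ normfV (gtr0_norm Nx) mulVf// gt_eqF.
rewrite leNgt; apply/negP => lt_x.
have lN : lower_semicontinuous (EFin \o N).
  apply/lower_semicontinuousP => a; apply: (@open_comp _ _ N [set t | a < t]).
    by move=> z _; exact: is_norm_continuous.
  exact: open_gt.
have cN : convex_efun (EFin \o N).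
  apply/convex_efunP => z z' r s t t0 t1; rewrite /= !lee_fin => zr zs.
  case: (normN) => ND _ _; apply: le_trans (ND _ _) _; rewrite !NZ.
  rewrite !ger0_norm ?subr_ge0//; by rewrite lerD// ler_wpM2l// subr_ge0.
have [y [b [minor xb]]] := affine_minorant_above (x0 := x) (a := coord_norm N d x)
  lN (fun=> isT) cN lt_x.
have b0 : 0 <= b.
  by have := minor 0; rewrite /= is_norm0// scalar_prod0l lee_fin; lra.
have yN z : scalar_prod z y <= N z.
  rewrite -subr_le0; apply: (@le0_of_scale_bound _ _ b) => t t0.
  have := minor (t *: z); rewrite /= NZ scalar_prodZl gtr0_norm// lee_fin; lra.
have : scalar_prod x y <= coord_norm N d x.
  by apply: coord_norm_ub => //; apply: dual_coord_norm_le => u [_ Nu]; exact: le_trans Nu.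
lra.
Qed.

Lemma coord_ball_full : (0 < d)%N -> coord_ball N d = unit_ball N.
Proof.
move=> d0; apply/funext => x; rewrite /unit_ball/= -coord_norm_full//.
by rewrite coord_ballE.
Qed.

End CoordinateNorms.

(** * Capra conjugates of functions of the number of nonzero components *)

(** This moves a supremum of reals through the subtraction of an extended real.
    With [X = -oo] the difference is [+oo] for every [a], and some point of [A]
    is needed to know that [G = +oo]. *)
Lemma EFin_sub_le_of_ub (R : realType) (T : Type) (A : set T) (f : T -> R) (a : R)
    (X G : \bar R) :
  A !=set0 -> (forall c, (forall s, A s -> f s <= c) -> a <= c) ->
  (forall s, A s -> ((f s)%:E - X <= G)%E) -> (a%:E - X <= G)%E.
Proof.
move=> [s0 As0] lub fG; case: X fG => [x| |] fG; last 2 first.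
- by rewrite /= addeNy leNye.
- by have := fG s0 As0; rewrite /= !addey.
case: G fG => [g| |] fG; last 2 first.
- by rewrite leey.
- by have := fG s0 As0.
rewrite -EFinB lee_fin lerBlDr; apply: lub => s /fG.
by rewrite -EFinB lee_fin lerBlDr.
Qed.

Section SupportExtension.
Context {R : realType} {d : nat}.

Lemma superset_card (K : {set 'I_d}) j : (#|K| <= j)%N -> (j <= d)%N ->
  exists2 M : {set 'I_d}, K \subset M & #|M| = j.
Proof.
elim: j => [|j IH]; first by rewrite leqn0 => /eqP; exists K.
rewrite leq_eqVlt => /orP[/eqP Kj _|]; first by exists K.
rewrite ltnS => Kj jd; have [M KM Mj] := IH Kj (ltnW jd).
have [i iM] : exists i, i \notin M.
  apply/existsP; rewrite -negb_forall; apply/negP => /forallP MT.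
  have : M = [set: 'I_d]%SET by apply/setP => i; rewrite MT inE.
  move=> /(congr1 (fun A : {set 'I_d} => #|A|)); rewrite cardsT card_ord Mj => jE.
  by rewrite jE ltnn in jd.
exists (i |: M)%SET; last by rewrite cardsU1 iM Mj.
by apply: fintype.subset_trans KM _; exact: finset.subsetUr.
Qed.

(** The direction [v] is the indicator of additional indices, disjoint from those
    of [u], so that nothing cancels along the half-line. *)
Lemma l0_perturb (u : 'rV[R]_d) (j : 'I_d.+1) : (#|nz_comps u| <= j)%N ->
  exists v, forall t, 0 < t -> l0 (u + t *: v) = j.
Proof.
move=> uj; have [M uM Mj] := superset_card uj (ltn_ord j).
exists (\row_i (i \in M :\: nz_comps u)%:R) => t t0; apply: val_inj => /=.
rewrite -Mj; congr #|pred_of_set _|; apply/setP => i; rewrite !inE !mxE !inE.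
have := fintype.subsetP uM i; rewrite inE.
have [->|ui] /= := eqVneq (u 0 i) 0; last by move=> ->//=; rewrite mulr0 addr0.
by move=> _; rewrite add0r; case: (i \in M); rewrite ?mulr1 ?mulr0 ?eqxx// gt_eqF.
Qed.

Lemma l0_surj (j : 'I_d.+1) : exists x : 'rV[R]_d, l0 x = j.
Proof.
have [|v vj] := @l0_perturb 0 j; first by rewrite nz_comps0 cards0.
by exists (0 + 1 *: v); exact: vj.
Qed.

End SupportExtension.

Section CapraConjugate.
Context {R : realType} {d : nat} (N : 'rV[R]_d -> R) (normN : is_norm N).
Implicit Types (x y u : 'rV[R]_d) (c : R) (phi : 'I_d.+1 -> \bar R).

Definition sup_dual phi y : \bar R :=
  ereal_sup [set ((dual_coord_norm N j y)%:E - phi j)%E | j in [set: 'I_d.+1]].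

Lemma le_sup_dualP phi y G :
  (sup_dual phi y <= G)%E <->
    (forall j : 'I_d.+1, ((dual_coord_norm N j y)%:E - phi j <= G)%E).
Proof.
split=> [sG j|sG]; last by apply: ge_ereal_sup => _ [j _ <-].
by apply: le_trans sG; apply: ereal_sup_ubound; exists j.
Qed.

Lemma capra_le_dual x y : capra N x y <= dual_coord_norm N (l0 x) y.
Proof.
rewrite /capra; case: eqVneq => [_|x0]; first exact: dual_coord_norm_ge0.
have Nx := is_norm_gt0 normN x0.
rewrite mulrC -scalar_prodZl; apply: dual_coord_norm_ub => //; split.
  by rewrite nz_compsZ// invr_eq0 gt_eqF.
by case: (normN) => _ NZ _; rewrite NZ normfV gtr0_norm// mulVf// gt_eqF.
Qed.

(** The supremum that defines the dual norm also runs over points with fewer than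
    [j] nonzero components; by [l0_perturb] each of them is a limit of points with
    exactly [j] of them. The bound [c] is nonnegative because the coupling is odd
    in its first argument. *)
Lemma dual_coord_norm_le_capra (j : 'I_d.+1) y c :
  (forall x, l0 x = j -> capra N x y <= c) -> dual_coord_norm N j y <= c.
Proof.
case: (normN) => ND NZ _ xc.
have capraN x : capra N (- x) y = - capra N x y.
  by rewrite /capra oppr_eq0 is_normN// scalar_prodNl mulNr; case: ifP; rewrite ?oppr0.
have c0 : 0 <= c.
  have [x xj] := @l0_surj R d j.
  have := xc (- x); rewrite capraN => /(_ _); have := xc x xj.
  have -> : l0 (- x) = j by apply: val_inj; rewrite -xj /= nz_compsN.
  by move=> ? /(_ erefl); lra.
have sc x : l0 x = j -> scalar_prod x y <= c * N x.
  move=> /xc; rewrite /capra; case: eqVneq => [->|x0].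
    by rewrite scalar_prod0l mulr_ge0 ?is_norm_ge0.
  by rewrite ler_pdivrMr// is_norm_gt0.
apply: dual_coord_norm_le => // u [uj Nu].
have [v vj] := l0_perturb uj.
rewrite -subr_le0; apply: (@le0_of_scale_bound _ _ (c * N v - scalar_prod v y)) => t t0.
have := sc _ (vj (t^-1) _); rewrite invr_gt0 => /(_ t0).
have tt : t * t^-1 = 1 by rewrite divff// gt_eqF.
rewrite scalar_prodDl scalar_prodZl => H.
have {H} : scalar_prod u y + t^-1 * scalar_prod v y <= c * (1 + t^-1 * N v).
  apply: le_trans H _; rewrite ler_wpM2l//; apply: le_trans (ND _ _) _.
  by rewrite NZ gtr0_norm ?invr_gt0// lerD2r.
move=> /(ler_wpM2l (ltW t0)); rewrite mulrDr mulrA tt mul1r.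
have -> : t * (c * (1 + t^-1 * N v)) = t * c + c * (t * t^-1) * N v by ring.
by rewrite tt; lra.
Qed.

(** Grouping the points by their number of nonzero components turns the
    conjugate into a supremum of suprema, one for each index. *)
Lemma capra_conj_l0 phi : capra_conj N (phi \o l0) = sup_dual phi.
Proof.
apply/funext => y; apply/eqP; rewrite eq_le; apply/andP; split.
  apply/le_conjugateP => x /=; apply: le_trans (iffLR (le_sup_dualP phi y _) (lexx _) (l0 x)).
  by apply: leeB => //; rewrite lee_fin capra_le_dual.
apply/le_sup_dualP => j; apply: (@EFin_sub_le_of_ub _ _ [set x | l0 x = j] (capra N ^~ y)).
- exact: l0_surj.
- exact: dual_coord_norm_le_capra.
- move=> x /= <-; exact: (iffLR (le_conjugateP (capra N) (phi \o l0) y _) (lexx _)).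
Qed.

Lemma capra_biconj_normalize f x : x != 0 ->
  capra_biconj N f x = rev_fenchel (capra_conj N f) ((N x)^-1 *: x).
Proof.
move=> x0; rewrite /capra_biconj /rev_fenchel /rev_conjugate; congr ereal_sup.
apply/seteqP; split=> _ [y _ <-]; exists y => //;
  by rewrite scalar_prodZl /capra (negbTE x0) mulrC.
Qed.

(** Both the coordinate balls and the coordinate spheres qualify as [A]: each
    [A j] has the dual coordinate-[j] norm as its support function. *)
Lemma fenchel_inf_family (A : nat -> set 'rV[R]_d) phi :
  (forall j, A j !=set0) -> (forall j, A j `<=` coord_ball N j) ->
  (forall j y c, (forall x, A j x -> scalar_prod x y <= c) -> dual_coord_norm N j y <= c) ->
  fenchel (fun x => ereal_inf [set phi j | j in [set j : 'I_d.+1 | A j x]]) = sup_dual phi.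
Proof.
move=> A0 AB supp; apply/funext => y; apply/eqP; rewrite eq_le; apply/andP; split.
  apply/le_conjugateP => x; rewrite lee_EFin_subC; apply: le_ereal_inf_tmp => _ [j /= Ajx <-].
  rewrite lee_EFin_subC; apply: le_trans (iffLR (le_sup_dualP phi y _) (lexx _) j).
  by apply: leeB => //; rewrite lee_fin; exact: (iffLR (coord_ballP normN j x) (AB j x Ajx)).
apply/le_sup_dualP => j; apply: (@EFin_sub_le_of_ub _ _ (A j) (scalar_prod ^~ y)) => //.
  exact: supp.
move=> x Ajx; apply: le_trans (fenchel_ge _ x y); apply: leeB => //.
by apply: ereal_inf_lbound; exists j.
Qed.

(** The upper addition matters here: a point outside [A j] contributes [+oo]
    even when [phi j = -oo]. *)
Lemma inf_delta_set (A : nat -> set 'rV[R]_d) phi x :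
  ereal_inf [set (delta_set (A j) x + phi j)%dE | j in [set: 'I_d.+1]] =
  ereal_inf [set phi j | j in [set j : 'I_d.+1 | A j x]].
Proof.
apply/eqP; rewrite eq_le; apply/andP; split; apply: le_ereal_inf_tmp => _ [j /= Aj <-].
  apply: ereal_inf_lbound; exists j => //; rewrite /delta_set mem_set//.
  exact: DualAddTheoryNumDomain.dadd0e.
rewrite /delta_set; case: ifPn => [/set_mem Ajx|_].
  by rewrite DualAddTheoryNumDomain.dadd0e; apply: ereal_inf_lbound; exists j.
by rewrite DualAddTheoryNumDomain.daddye leey.
Qed.

(** A closed convex minorant of [f] is its own biconjugate, hence lies below the
    biconjugate of [f]. *)
Lemma largest_closed_convex_below_biconj (f : 'rV[R]_d -> \bar R) :
  largest_closed_convex_below (fenchel_biconj f) f.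
Proof.
split; [exact: closed_rev_fenchel|exact: convex_rev_fenchel|exact: fenchel_biconj_le|].
move=> h ch vh hf x; rewrite -(fenchel_biconj_id ch vh).
exact: fenchel_biconj_mono.
Qed.

End CapraConjugate.

(** * Lower boundary of a compact convex set *)

Section LowerBoundary.
Context {R : realType} {d : nat} (E : set ('rV[R]_d * R)).
Implicit Types (x y : 'rV[R]_d) (r a : R).

Definition lower_boundary x : \bar R := ereal_inf [set r%:E | r in [set r | E (x, r)]].

Context (cE : compact E).

Lemma lower_boundary_attained x : (exists r, E (x, r)) ->
  exists2 r, E (x, r) & lower_boundary x = r%:E.
Proof.
move=> [r0 Er0]; pose S := E `&` fst @^-1` [set x].
have cS : compact S.
  apply: compact_closedI => //; apply: preimage_closed.
    by move=> p _; exact: cvg_fst.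
  exact: (compact_closed (@norm_hausdorff _ _) (@compact_set1 _ x)).
have S0 : S !=set0 by exists (x, r0).
have csnd : {within S, continuous (snd : 'rV[R]_d * R -> R)}.
  by apply: continuous_subspaceT => p; exact: cvg_snd.
have [[x1 r] /set_mem[/= Er xx] rmin] := compact_EVT_min S0 cS csnd.
rewrite {}xx in Er rmin; exists r => //; apply/eqP; rewrite eq_le; apply/andP; split.
  by apply: ereal_inf_lbound; exists r.
apply: le_ereal_inf_tmp => _ [s /= Es <-]; rewrite lee_fin.
by apply: (rmin (x, s)); apply: mem_set.
Qed.

Lemma lower_boundary_leP x a :
  (lower_boundary x <= a%:E)%E <-> exists2 r, E (x, r) & r <= a.
Proof.
split=> [xa|[r Er ra]]; last first.
  have xr : (lower_boundary x <= r%:E)%E by apply: ereal_inf_lbound; exists r.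
  by apply: le_trans xr _; rewrite lee_fin.
have [/lower_boundary_attained[r Er xr]|nE] := pselect (exists r, E (x, r)).
  by exists r => //; rewrite -lee_fin -xr.
suff xoo : lower_boundary x = +oo%E by rewrite xoo in xa.
apply/eqP; rewrite -leye_eq; apply: le_ereal_inf_tmp => _ [s /= Es <-].
by case: nE; exists s.
Qed.

Lemma lower_boundary_neqNy x : lower_boundary x != -oo%E.
Proof.
apply/eqP => xNy.
have [r Er _] : exists2 r, E (x, r) & r <= 0 by apply/lower_boundary_leP; rewrite xNy leNye.
by have [s _] := lower_boundary_attained (ex_intro _ r Er); rewrite xNy.
Qed.

(** The sublevel sets are projections of compact sets, hence closed. *)
Lemma lsc_lower_boundary : lower_semicontinuous lower_boundary.
Proof.
apply/lower_semicontinuousP => a.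
have cS : compact (fst @` (E `&` snd @^-1` [set r | r <= a])).
  apply: continuous_compact.
    by apply: continuous_subspaceT => p; exact: cvg_fst.
  apply: compact_closedI => //; apply: preimage_closed; last exact: closed_le.
  by move=> p _; exact: cvg_snd.
have -> : [set x | (a%:E < lower_boundary x)%E] =
    ~` (fst @` (E `&` snd @^-1` [set r | r <= a])); last first.
  apply: closed_openC; exact: compact_closed (@norm_hausdorff _ _) cS.
apply/seteqP; split=> x /=.
  rewrite ltNge => /negP xa [[x' r] [/= Er ra] /= xx]; apply: xa.
  by apply/lower_boundary_leP; exists r; rewrite -?xx.
move=> nS; rewrite ltNge; apply/negP => /lower_boundary_leP[r Er ra].
by apply: nS; exists (x, r).
Qed.

Context (vE : forall p q t, E p -> E q -> 0 <= t -> t <= 1 ->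
  E (t *: p.1 + (1 - t) *: q.1, t * p.2 + (1 - t) * q.2)).

Lemma convex_lower_boundary : convex_efun lower_boundary.
Proof.
apply/convex_efunP => x y r s t t0 t1 /lower_boundary_leP[r' Er rr].
move=> /lower_boundary_leP[s' Es ss]; apply/lower_boundary_leP.
exists (t * r' + (1 - t) * s'); first exact: (vE Er Es).
by rewrite lerD// ler_wpM2l// subr_ge0.
Qed.

Lemma fenchel_biconj_lower_boundary : fenchel_biconj lower_boundary = lower_boundary.
Proof.
apply: fenchel_biconj_id; last exact: convex_lower_boundary.
by left; split; [exact: lsc_lower_boundary|exact: lower_boundary_neqNy].
Qed.

End LowerBoundary.

(** * Convex combinations of the coordinate balls *)

Section Compactness.
Context {R : realType}.

Lemma compact_simplex n : compact (@simplex R n).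
Proof.
have -> : @simplex R n = [set v : 'rV[R]_n | forall i, `[0, 1]%classic (v ord0 i)] `&`
    (fun v : 'rV[R]_n => \sum_j v 0 j) @^-1` [set 1].
  apply/seteqP; split=> [v [v0 v1]|v [/= v01 v1]]; split=> // i.
  - rewrite /= in_itv/= v0 /= -v1 (bigD1 i)//= lerDl.
    by apply: sumr_ge0 => j _; exact: v0.
  - by have := v01 i; rewrite in_itv/= => /andP[].
apply: compact_closedI.
  exact: (@rV_compact R n (fun=> `[0, 1]%classic) (fun=> @segment_compact R 0 1)).
apply: preimage_closed; last exact: closed_eq.
by move=> v _; apply: continuous_sumr => i w; exact: coord_continuous.
Qed.

Lemma compact_coord_ball (d : nat) (N : 'rV[R]_d -> R) (normN : is_norm N) k :
  compact (coord_ball N k).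
Proof.
pose e i : 'rV[R]_d := delta_mx 0 i.
pose D := dual_coord_norm N k.
pose B := [set v : 'rV[R]_d | forall i, `[- D (- e i), D (e i)]%classic (v ord0 i)].
have cB : compact B.
  apply: (@rV_compact _ _ (fun i => `[- D (- e i), D (e i)]%classic)) => i.
  exact: segment_compact.
apply: subclosed_compact cB _.
  have -> : coord_ball N k = \bigcap_y [set x | scalar_prod x y <= D y].
    apply/funext => x; apply/propext; rewrite (coord_ballP normN).
    by split=> [H y _|H y]; exact: H.
  apply: closed_bigI => y _.
  apply: (@preimage_closed _ _ (scalar_prod^~ y) [set u | u <= D y]); last exact: closed_le.
  by move=> x _; exact: scalar_prod_continuousl.
move=> x /(coord_ballP normN) Bx i; rewrite /= in_itv/=.
have := Bx (e i); have := Bx (- e i).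
rewrite scalar_prodNr (scalar_prodC x (e i)) scalar_prod_delta => H1 H2.
by apply/andP; split; rewrite // lerNl.
Qed.

End Compactness.

Section BallDecomposition.
Context {R : realType} {d : nat} (N : 'rV[R]_d -> R) (normN : is_norm N).
Context (phi : 'I_d.+1 -> R).
Implicit Types (x y : 'rV[R]_d) (lam : 'rV[R]_d.+1).
Local Notation S := (lift ord0).

(** Keeping the scaled terms [z j = lam_j b_j] instead of the points [b_j] makes
    the constraints jointly convex in [lam] and [z]. *)
Lemma simplex_decomp_ballP x lam : simplex_decomp (coord_ball N) x lam <->
  simplex lam /\ exists2 z : 'I_d -> 'rV[R]_d, \sum_j z j = x &
    forall j y, scalar_prod (z j) y <= lam 0 (S j) * dual_coord_norm N (S j) y.
Proof.
split=> [[slam [z zB zx]]|[slam [z zx zB]]].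
- split=> //; exists z => // j y.
  by move: (zB j) => /(scale_coord_ballP normN _ _ (slam.1 _)).
- split=> //; exists z => // j.
  by apply/(scale_coord_ballP normN _ _ (slam.1 _)) => y; exact: zB.
Qed.

Let cost lam := \sum_j lam 0 j * phi j.

(** The convex hull of the sets [B_(j) x {phi j}], [j] in [{0, ..., d}]. *)
Definition ball_graph_hull : set ('rV[R]_d * R) :=
  [set p | exists2 lam, simplex_decomp (coord_ball N) p.1 lam & cost lam = p.2].

Lemma ball_graph_hull_vertex (j : 'I_d.+1) x :
  coord_ball N j x -> ball_graph_hull (x, phi j).
Proof.
move=> Bx; exists (delta_mx 0 j); last first.
  rewrite /cost (bigD1 j)//= big1 => [|i ij]; rewrite !mxE ?eqxx ?mul1r ?addr0//.
  by rewrite (negbTE ij) mul0r.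
apply/simplex_decomp_ballP; split.
  split=> [i|]; first by rewrite mxE ler0n.
  rewrite (bigD1 j)//= big1 => [|i ij]; rewrite !mxE ?eqxx ?addr0//.
  by rewrite (negbTE ij).
exists (fun i => if S i == j then x else 0) => [|i z].
  case: (unliftP ord0 j) Bx => [i ->|->] Bx.
    by rewrite (bigD1 i)//= eqxx big1 ?addr0// => i' ne; rewrite (inj_eq lift_inj) (negbTE ne).
  by rewrite big1.
rewrite mxE eqxx andTb; case: eqVneq => [ij|_]; last by rewrite scalar_prod0l mul0r.
by rewrite mul1r ij; exact: (iffLR (coord_ballP normN j x) Bx).
Qed.

Lemma convex_ball_graph_hull p q t : ball_graph_hull p -> ball_graph_hull q ->
  0 <= t -> t <= 1 ->
  ball_graph_hull (t *: p.1 + (1 - t) *: q.1, t * p.2 + (1 - t) * q.2).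
Proof.
move=> [lam /simplex_decomp_ballP[[lam0 lam1] [z zx zB]] <-].
move=> [mu /simplex_decomp_ballP[[mu0 mu1] [w wx wB]] <-] t0 t1.
have t1' : 0 <= 1 - t by rewrite subr_ge0.
exists (t *: lam + (1 - t) *: mu) => /=; last first.
  rewrite /cost !mulr_sumr -big_split; apply: eq_bigr => j _.
  by rewrite !mxE /=; ring.
apply/simplex_decomp_ballP; split.
  split=> [j|]; first by rewrite !mxE addr_ge0// mulr_ge0.
  have -> : \sum_j (t *: lam + (1 - t) *: mu) 0 j =
      t * \sum_j lam 0 j + (1 - t) * \sum_j mu 0 j.
    by rewrite !mulr_sumr -big_split; apply: eq_bigr => j _; rewrite !mxE.
  by rewrite lam1 mu1; ring.
exists (fun j => t *: z j + (1 - t) *: w j) => [|j y].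
  by rewrite big_split -!scaler_sumr zx wx.
set D := dual_coord_norm N _ y.
have -> : (t *: lam + (1 - t) *: mu) 0 (S j) * D =
    t * (lam 0 (S j) * D) + (1 - t) * (mu 0 (S j) * D) by rewrite !mxE; ring.
by rewrite scalar_prodDl !scalar_prodZl lerD// ler_wpM2l// (zB, wB).
Qed.

(** For compactness the hull is parametrized by the points [b_j] of the balls,
    which range over a product independent of [lam]. *)
Lemma compact_ball_graph_hull : compact ball_graph_hull.
Proof.
pose Z := prod_topology (fun _ : 'I_d => 'rV[R]_d).
pose P : set ('rV[R]_d.+1 * Z) :=
  simplex `*` [set b | forall j, coord_ball N (S j) (b j)].
pose F (p : 'rV[R]_d.+1 * Z) : 'rV[R]_d * R :=
  (\sum_j p.1 0 (S j) *: (p.2 : 'I_d -> 'rV[R]_d) j, cost p.1).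
have -> : ball_graph_hull = F @` P.
  apply/seteqP; split=> [[x r] [lam [slam [z zB /= zx]] /= <-]|_ [[lam b] [slam bB] <-]].
    have /choice[b bP] : forall j, exists b, coord_ball N (S j) b /\ lam 0 (S j) *: b = z j.
      by move=> j; have [b Bb bz] := zB j; exists b.
    exists (lam, b); first by split => //= j; have [] := bP j.
    by rewrite /F/= -zx; congr pair; apply: eq_bigr => j _; have [] := bP j.
  exists lam => //=; split => //.
  exists (fun j => lam 0 (S j) *: (b : 'I_d -> 'rV[R]_d) j) => // j.
  by exists ((b : 'I_d -> 'rV[R]_d) j) => //; exact: bB.
apply: continuous_compact; last first.
  apply: compact_setX; first exact: compact_simplex.
  apply: (@tychonoff 'I_d (fun=> 'rV[R]_d) (fun j => coord_ball N (S j))) => j.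
  exact: compact_coord_ball.
apply: continuous_subspaceT => p.
have ccoord j : continuous (fun p : 'rV[R]_d.+1 * Z => p.1 0 j).
  apply: (@continuous_comp_fst _ _ _ (fun v : 'rV[R]_d.+1 => v 0 j)).
  exact: coord_continuous.
have cproj j : continuous (fun p : 'rV[R]_d.+1 * Z => (p.2 : 'I_d -> 'rV[R]_d) j).
  apply: (@continuous_comp_snd _ _ _ (fun b : Z => (b : 'I_d -> 'rV[R]_d) j)).
  exact: proj_continuous.
have c1 : continuous (fun p : 'rV[R]_d.+1 * Z =>
    \sum_j p.1 0 (S j) *: (p.2 : 'I_d -> 'rV[R]_d) j).
  apply: continuous_sumr => j q; exact: (continuousZ (ccoord (S j) q) (cproj j q)).
have c2 : continuous (fun p : 'rV[R]_d.+1 * Z => cost p.1).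
  apply: (@continuous_sumr R R^o) => j q; apply: (@continuousM _ _
    (fun p : 'rV[R]_d.+1 * Z => p.1 0 j) (cst (phi j)));
    [exact: ccoord|exact: cst_continuous].
exact: (cvg_pair (c1 p) (c2 p)).
Qed.

(** A linear function on a convex hull is bounded by its bounds on the generating
    sets [B_(j) x {phi j}], where its supremum is [dual_coord_norm - phi j]. *)
Lemma fenchel_ball_graph_hull :
  fenchel (lower_boundary ball_graph_hull) = sup_dual N (EFin \o phi).
Proof.
apply/funext => y; apply/eqP; rewrite eq_le; apply/andP; split.
- apply/le_conjugateP => x; rewrite lee_EFin_subC; apply: le_ereal_inf_tmp.
  move=> _ [r [lam /simplex_decomp_ballP[[lam0 lam1] [z /= zx zB]] /= lamr] <-].
  rewrite lee_EFin_subC -EFinB.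
  have := iffLR (le_sup_dualP N (EFin \o phi) y _) (lexx _).
  case: (sup_dual N (EFin \o phi) y) => [s| |] H; [|by rewrite leey|by have := H ord0].
  have {}H (j : 'I_d.+1) : dual_coord_norm N j y - phi j <= s.
    by have := H j; rewrite -EFinB lee_fin.
  move: zx lamr => /= <- <-; rewrite lee_fin scalar_prod_suml.
  apply: (@le_trans _ _ (\sum_j lam 0 j * (dual_coord_norm N j y - phi j))); last first.
    rewrite -[s]mul1r -lam1 mulr_suml; apply: ler_sum => j _; exact: ler_wpM2l.
  under [leRHS]eq_bigr do rewrite mulrBr.
  rewrite sumrB lerD2r [leRHS]big_ord_recl [X in X + _]mulr0 add0r.
  by apply: ler_sum => j _; exact: zB.
- apply/le_sup_dualP => j.
  apply: (@EFin_sub_le_of_ub _ _ (coord_ball N j) (scalar_prod ^~ y)).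
  + by exists 0; exact: coord_ball0.
  + exact: dual_coord_norm_le_ball.
  move=> x Bx; apply: le_trans (fenchel_ge _ x y); apply: leeB => //.
  by apply: ereal_inf_lbound; exists (phi j) => //; exact: ball_graph_hull_vertex.
Qed.

Lemma rev_fenchel_lower_boundary :
  rev_fenchel (sup_dual N (EFin \o phi)) = lower_boundary ball_graph_hull.
Proof.
rewrite -fenchel_ball_graph_hull; apply: fenchel_biconj_lower_boundary.
  exact: compact_ball_graph_hull.
exact: convex_ball_graph_hull.
Qed.

Lemma is_min_lower_boundary x :
  is_min (simplex_decomp (coord_ball N) x) (fun lam => (cost lam)%:E)
    (lower_boundary ball_graph_hull x).
Proof.
split.
  congr ereal_inf; apply/seteqP; split=> [_ [r [lam lamx /= <-] <-]|_ [lam lamx <-]].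
    by exists lam.
  by exists (cost lam) => //; exists lam.
move=> [lam lamx].
have [|r [mu mux /= mur] ->] := @lower_boundary_attained _ _ _ compact_ball_graph_hull x.
  by exists (cost lam); exists lam.
by exists mu; rewrite ?mur.
Qed.

End BallDecomposition.

(** * Passing between minimisation problems *)

Section Minimum.
Context {R : realType}.
Local Open Scope ereal_scope.

(** Only costs are compared, not the points that carry them; this allows a
    decomposition to be normalized on the way from one problem to the other. *)
Lemma is_min_transfer (S T : Type) (A : set S) (B : set T) (F : S -> \bar R)
    (G : T -> \bar R) v :
  (forall a, A a -> exists2 b, B b & G b <= F a) ->
  (forall b, B b -> exists2 a, A a & F a <= G b) ->
  is_min A F v -> is_min B G v.
Proof.
move=> AB BA [vF Fattained]; have vG : v = ereal_inf (G @` B).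
  rewrite vF; apply/eqP; rewrite eq_le; apply/andP; split.
    apply: le_ereal_inf_tmp => _ [b /BA[a Aa FG] <-]; apply: le_trans FG.
    by apply: ereal_inf_lbound; exists a.
  apply: le_ereal_inf_tmp => _ [a /AB[b Bb GF] <-]; apply: le_trans GF.
  by apply: ereal_inf_lbound; exists b.
split=> // -[b /BA[a Aa _]]; have [|a0 Aa0 Fa0] := Fattained; first by exists a.
have [b0 Bb0 Gb0] := AB _ Aa0; exists b0 => //; apply/eqP.
by rewrite eq_le -{1}Fa0 Gb0 vG ereal_inf_lbound//; exists b0.
Qed.

Lemma is_min_pmul (T : Type) (A : set T) (F : T -> \bar R) (c : R) v :
  (0 < c)%R -> is_min A F v -> is_min A (fun a => c%:E * F a) (c%:E * v).
Proof.
move=> c0 [vF Fattained]; split; last first.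
  by move=> /Fattained[a Aa Fa]; exists a; rewrite ?Fa.
have [/Fattained[a Aa Fa]|A0] := pselect (A !=set0); last first.
  have AE : A = set0 by apply/seteqP; split=> // a Aa; apply: A0; exists a.
  by rewrite vF AE !image_set0 ereal_inf0 gt0_muley// lte_fin.
apply/eqP; rewrite eq_le; apply/andP; split.
  apply: le_ereal_inf_tmp => _ [b Ab <-]; rewrite lee_pmul2l// vF.
  by apply: ereal_inf_lbound; exists b.
by rewrite -Fa; apply: ereal_inf_lbound; exists a.
Qed.

End Minimum.

Section NonnegativeCosts.
Context {R : realType} {d : nat} (N : 'rV[R]_d -> R) (normN : is_norm N).
Context (phi : 'I_d.+1 -> R) (phi_ge0 : forall j, 0 <= phi j) (phi0 : phi ord0 = 0).
Implicit Types (x y : 'rV[R]_d) (lam : 'rV[R]_d.+1).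
Local Notation S := (lift ord0).

Let cost lam := \sum_j lam 0 j * phi j.

Let costE lam : cost lam = \sum_j lam 0 (S j) * phi (S j).
Proof. by rewrite /cost big_ord_recl phi0 mulr0 add0r. Qed.

(** Measuring each term of a decomposition by its own norm, instead of by its
    weight, does not increase the total weight nor the cost. *)
Lemma norm_decomp_of_ball x lam : simplex_decomp (coord_ball N) x lam ->
  exists2 z, norm_decomp N 1 x z &
    \sum_j phi (S j) * coord_norm N (S j) (z j) <= cost lam.
Proof.
move=> [[lam0 lam1] [z zB zx]].
have zn j : coord_norm N (S j) (z j) <= lam 0 (S j).
  by apply/(scale_coord_ball_le normN); [rewrite lift0|exact: lam0|exact: zB].
exists z.
  split=> //; rewrite -lam1 [leRHS]big_ord_recl.
  by rewrite ler_wpDl//; apply: ler_sum => j _; exact: zn.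
by rewrite costE; apply: ler_sum => j _; rewrite mulrC ler_wpM2r.
Qed.

(** The norms of the terms serve as weights, and what is missing to a total of 1
    goes to index 0, whose cost is zero. A zero term gets weight 0, so any point
    of the sphere represents it. *)
Lemma sphere_of_norm_decomp x z : norm_decomp N 1 x z ->
  exists2 lam, simplex_decomp (coord_sphere N) x lam &
    cost lam = \sum_j phi (S j) * coord_norm N (S j) (z j).
Proof.
move=> [z1 zx]; pose n (j : 'I_d) := coord_norm N (S j) (z j).
have n0 j : 0 <= n j by apply: coord_norm_ge0 => //; rewrite lift0.
pose lam : 'rV[R]_d.+1 :=
  \row_j (if unlift ord0 j is Some i then n i else 1 - \sum_(i < d) n i).
have lam0 : lam 0 ord0 = 1 - \sum_(i < d) n i by rewrite mxE unlift_none.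
have lamS j : lam 0 (S j) = n j by rewrite mxE liftK.
exists lam; last by rewrite costE; apply: eq_bigr => j _; rewrite lamS mulrC.
split.
  split=> [j|]; last first.
    by rewrite big_ord_recl lam0 [X in _ + X](eq_bigr n) ?subrK// => j _; exact: lamS.
  by case: (unliftP ord0 j) => [i|] ->; rewrite ?lamS// lam0 subr_ge0.
exists z => // j; rewrite lamS.
have Sj0 : (0 < S j)%N by rewrite lift0.
have [zj0|zj0] := eqVneq (z j) 0.
  have [s Ss] := coord_sphere_neq0 normN (S j) (leq_ltn_trans (leq0n j) (ltn_ord j)).
  by exists s => //; rewrite /n zj0 coord_norm0// scale0r.
exists ((n j)^-1 *: z j); first exact: coord_sphere_normalize.
rewrite scalerA divff ?scale1r//.
by apply: contraNneq zj0 => /(coord_norm_eq0 normN Sj0) ->.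
Qed.

Lemma ball_of_sphere x lam :
  simplex_decomp (coord_sphere N) x lam -> simplex_decomp (coord_ball N) x lam.
Proof.
move=> [slam [z zS zx]]; split => //; exists z => // j.
have [s Ss <-] := zS j; exists s => //; exact: coord_sphere_sub_ball.
Qed.

Lemma is_min_sphere x v :
  is_min (simplex_decomp (coord_ball N) x) (fun lam => (cost lam)%:E) v ->
  is_min (simplex_decomp (coord_sphere N) x)
    (fun lam => (\sum_(j < d) lam 0 (S j) * phi (S j))%:E) v.
Proof.
apply: is_min_transfer => [lam /norm_decomp_of_ball[z zx zl]|mu mux].
  have [mu mux muE] := sphere_of_norm_decomp zx.
  by exists mu; rewrite // -costE lee_fin muE.
by exists mu; [exact: ball_of_sphere|rewrite -costE].
Qed.

Lemma is_min_norm_decomp x v :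
  is_min (simplex_decomp (coord_ball N) x) (fun lam => (cost lam)%:E) v ->
  is_min (norm_decomp N 1 x)
    (fun z => (\sum_(j < d) phi (S j) * coord_norm N (S j) (z j))%:E) v.
Proof.
apply: is_min_transfer => [lam /norm_decomp_of_ball[z zx zl]|z].
  by exists z; rewrite ?lee_fin.
move=> /sphere_of_norm_decomp[mu /ball_of_sphere mux muE].
by exists mu; rewrite ?lee_fin ?muE.
Qed.

Lemma is_min_norm_decomp_scale x (c : R) v : 0 < c ->
  is_min (norm_decomp N 1 (c^-1 *: x))
    (fun z => (\sum_(j < d) phi (S j) * coord_norm N (S j) (z j))%:E) v ->
  is_min (norm_decomp N c x)
    (fun z => (\sum_(j < d) coord_norm N (S j) (z j) * phi (S j))%:E) (c%:E * v)%E.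
Proof.
move=> c0 /(is_min_pmul c0); have cn0 : c != 0 by rewrite gt_eqF.
have nZ a (z : 'rV[R]_d) (j : 'I_d) : 0 <= a ->
    coord_norm N (S j) (a *: z) = a * coord_norm N (S j) z.
  by move=> a0; rewrite coord_normZ// lift0.
have costZ a (z : 'I_d -> 'rV[R]_d) : 0 <= a ->
    \sum_j coord_norm N (S j) (a *: z j) * phi (S j) =
    a * \sum_j phi (S j) * coord_norm N (S j) (z j).
  by move=> a0; rewrite mulr_sumr; apply: eq_bigr => j _; rewrite nZ//; ring.
have sumZ a (z : 'I_d -> 'rV[R]_d) : 0 <= a ->
    \sum_j coord_norm N (S j) (a *: z j) = a * \sum_j coord_norm N (S j) (z j).
  by move=> a0; rewrite mulr_sumr; apply: eq_bigr => j _; rewrite nZ.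
apply: is_min_transfer => [z [z1 zx]|z [zc zx]].
- exists (fun j => c *: z j); last by rewrite (costZ _ _ (ltW c0)) EFinM.
  split; first by rewrite (sumZ _ _ (ltW c0)) -[leRHS]mulr1 ler_wpM2l// ltW.
  by rewrite -scaler_sumr zx scalerA divff// scale1r.
- exists (fun j => c^-1 *: z j); last first.
    rewrite -EFinM lee_fin -(costZ _ _ (ltW c0)).
    rewrite [leLHS](eq_bigr (fun j => coord_norm N (S j) (z j) * phi (S j)))// => j _.
    by rewrite scalerA divff// scale1r.
  split; last by rewrite -scaler_sumr zx.
  have ci0 : 0 <= c^-1 by rewrite invr_ge0 ltW.
  by rewrite (sumZ _ _ ci0) ler_pdivrMl// mulr1.
Qed.

End NonnegativeCosts.

(** * The proposition *)

Section InfOverFamily.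
Context {R : realType} {d : nat} (N : 'rV[R]_d -> R) (normN : is_norm N).
Implicit Types (phi : 'I_d.+1 -> \bar R) (x : 'rV[R]_d).

Lemma coord_ball_index (l : 'I_d.+1) x : (coord_ball N l `\` coord_ball N l.-1) x ->
  [set j : 'I_d.+1 | coord_ball N j x] = [set j : 'I_d.+1 | (l <= j)%N].
Proof.
move=> [lx nlx]; apply/seteqP; split=> j /=; last by move=> /(coord_ball_mono normN); exact.
move=> jx; rewrite leqNgt; apply/negP => jl; apply: nlx.
by apply: (coord_ball_mono normN) jx; case: (nat_of_ord l) jl.
Qed.

Lemma ereal_inf_nondecreasing phi (l : 'I_d.+1) :
  (forall j k : 'I_d.+1, (j <= k)%N -> (phi j <= phi k)%E) ->
  ereal_inf [set phi j | j in [set j : 'I_d.+1 | (l <= j)%N]] = phi l.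
Proof.
move=> phim; apply/eqP; rewrite eq_le; apply/andP; split.
  by apply: ereal_inf_lbound; exists l => /=.
by apply: le_ereal_inf_tmp => _ [j /= lj <-]; exact: phim.
Qed.

End InfOverFamily.

Theorem proposition4p5 (R : realType) (d : nat) (N : 'rV[R]_d -> R)
    (d_ge1 : (1 <= d)%N) (normN : is_norm N) :
  (* (1) *)
  (forall phi : 'I_d.+1 -> \bar R,
    let L : 'rV[R]_d -> \bar R := rev_fenchel (capra_conj N (phi \o l0)) in
    let ballfun : 'rV[R]_d -> \bar R := fun x =>
      ereal_inf [set (delta_set (coord_ball N j) x + phi j)%dE
                | j in [set: 'I_d.+1]] in
    let spherefun : 'rV[R]_d -> \bar R := fun x =>
      ereal_inf [set (delta_set (coord_sphere N j) x + phi j)%dE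
                | j in [set: 'I_d.+1]] in
    (forall x : 'rV[R]_d, x != 0 -> capra_biconj N (phi \o l0) x = L ((N x)^-1 *: x)) /\
    (closed_efun L /\ convex_efun L) /\
    (L = rev_fenchel (fun y =>
           ereal_sup [set ((dual_coord_norm N j y)%:E - phi j)%E
                     | j in [set: 'I_d.+1]])) /\
    (* balls *)
    (L = fenchel_biconj ballfun) /\
    largest_closed_convex_below L ballfun /\
    [/\ forall (l : 'I_d.+1) x, (0 < l)%N ->
          (coord_ball N l `\` coord_ball N l.-1) x ->
          ballfun x = ereal_inf [set phi j | j in [set j : 'I_d.+1 | (l <= j)%N]],
        ballfun 0 = ereal_inf [set phi j | j in [set: 'I_d.+1]],
        (forall j k : 'I_d.+1, (j <= k)%N -> (phi j <= phi k)%E) ->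
          (forall (l : 'I_d.+1) x, (0 < l)%N ->
            (coord_ball N l `\` coord_ball N l.-1) x -> ballfun x = phi l) /\
          (forall x, coord_ball N 0 x -> ballfun x = phi ord0),
        coord_ball N d = unit_ball N &
        forall x, ~ coord_ball N d x -> ballfun x = +oo%E] /\
    (L = fenchel_biconj (fun x =>
           ereal_inf [set phi j | j in [set j : 'I_d.+1 | coord_ball N j x]])) /\
    (* spheres *)
    (L = fenchel_biconj spherefun) /\
    largest_closed_convex_below L spherefun /\
    (L = fenchel_biconj (fun x =>
           ereal_inf [set phi j | j in [set j : 'I_d.+1 | coord_sphere N j x]]))) /\
  (* (2) *)
  (forall phi : 'I_d.+1 -> R,
    let L : 'rV[R]_d -> \bar R :=
      rev_fenchel (capra_conj N (EFin \o phi \o l0)) in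
    [/\ proper_efun L, convex_efun L & lower_semicontinuous L] /\
    (forall x, is_min (simplex_decomp (coord_ball N) x)
                 (fun lam => (\sum_(j < d.+1) lam 0 j * phi j)%:E) (L x))) /\
  (* (3) *)
  (forall phi : 'I_d.+1 -> R,
    (forall j, 0 <= phi j) -> phi ord0 = 0 ->
    let L : 'rV[R]_d -> \bar R :=
      rev_fenchel (capra_conj N (EFin \o phi \o l0)) in
    [/\ proper_efun L, convex_efun L & lower_semicontinuous L] /\
    (forall x,
      is_min (simplex_decomp (coord_sphere N) x)
        (fun lam =>
          (\sum_(j < d) lam 0 (lift ord0 j) * phi (lift ord0 j))%:E) (L x) /\
      is_min (norm_decomp N 1 x)
        (fun z =>
          (\sum_(j < d) phi (lift ord0 j) * coord_norm N (lift ord0 j) (z j))%:E)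
        (L x)) /\
    (forall x : 'rV[R]_d, x != 0 ->
      exists m : \bar R,
        is_min (norm_decomp N (N x) x)
          (fun z =>
            (\sum_(j < d) coord_norm N (lift ord0 j) (z j) * phi (lift ord0 j))%:E)
          m /\
        capra_biconj N (EFin \o phi \o l0) x = ((N x)^-1%:E * m)%E)).
Proof.
have supp_ball j y c : (forall x, coord_ball N j x -> scalar_prod x y <= c) ->
    dual_coord_norm N j y <= c by exact: dual_coord_norm_le_ball.
have supp_sphere j y c : (forall x, coord_sphere N j x -> scalar_prod x y <= c) ->
    dual_coord_norm N j y <= c by exact: dual_coord_norm_le_sphere.
have fenchel_ball phi := @fenchel_inf_family _ _ N normN (coord_ball N) phi
  (fun j => ex_intro _ 0 (coord_ball0 normN j)) (fun j => @subset_refl _ _) supp_ball.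
have fenchel_sphere phi := @fenchel_inf_family _ _ N normN (coord_sphere N) phi
  (fun j => coord_sphere_neq0 normN j d_ge1) (@coord_sphere_sub_ball _ _ N) supp_sphere.
have closed_proper (phi : 'I_d.+1 -> R) : 
    let L := rev_fenchel (capra_conj N (EFin \o phi \o l0)) in
    [/\ proper_efun L, convex_efun L & lower_semicontinuous L] /\
    (forall x, is_min (simplex_decomp (coord_ball N) x)
       (fun lam => (\sum_(j < d.+1) lam 0 j * phi j)%:E) (L x)).
  move=> L; have LE : L = lower_boundary (ball_graph_hull N phi).
    by rewrite /L capra_conj_l0// rev_fenchel_lower_boundary.
  have cE : compact (ball_graph_hull N phi) by exact: compact_ball_graph_hull.
  split; last by move=> x; rewrite LE; exact: is_min_lower_boundary.
  split; [|exact: convex_rev_fenchel|exact: lsc_rev_fenchel].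
  rewrite LE; split=> [x|]; first exact: lower_boundary_neqNy.
  have [|r _ rE] := lower_boundary_attained (x := 0) cE.
    by exists (phi ord0); exact: ball_graph_hull_vertex.
  by exists 0; rewrite rE.
split; [|split] => phi.
- move=> L ballfun spherefun.
  have ballE : ballfun = fun x =>
      ereal_inf [set phi j | j in [set j : 'I_d.+1 | coord_ball N j x]].
    by apply/funext => x; exact: inf_delta_set.
  have sphereE : spherefun = fun x =>
      ereal_inf [set phi j | j in [set j : 'I_d.+1 | coord_sphere N j x]].
    by apply/funext => x; exact: inf_delta_set.
  have LE : L = rev_fenchel (sup_dual N phi) by rewrite /L capra_conj_l0.
  have Lball : L = fenchel_biconj ballfun.
    by rewrite LE ballE /fenchel_biconj fenchel_ball.
  have Lsphere : L = fenchel_biconj spherefun.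
    by rewrite LE sphereE /fenchel_biconj fenchel_sphere.
  have ball_inf (l : 'I_d.+1) x : (coord_ball N l `\` coord_ball N l.-1) x ->
      ballfun x = ereal_inf [set phi j | j in [set j : 'I_d.+1 | (l <= j)%N]].
    by move=> /(coord_ball_index normN) lx; rewrite ballE lx.
  have ball_inf0 : ballfun 0 = ereal_inf [set phi j | j in [set: 'I_d.+1]].
    rewrite ballE; congr (ereal_inf (phi @` _)); apply/seteqP; split=> // j _.
    exact: coord_ball0.
  split; first by move=> x x0; exact: capra_biconj_normalize.
  split; first by split; [exact: closed_rev_fenchel|exact: convex_rev_fenchel].
  split; first exact: LE.
  split; first exact: Lball.
  split; first by rewrite Lball; exact: largest_closed_convex_below_biconj.
  split.
    split; [by move=> l x _; exact: ball_inf|exact: ball_inf0| |exact: coord_ball_full|].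
      move=> phim; split=> [l x _ /ball_inf ->|x /= ->].
        exact: ereal_inf_nondecreasing.
      rewrite ball_inf0 -(ereal_inf_nondecreasing ord0 phim).
      by congr (ereal_inf (phi @` _)); apply/seteqP; split.
    move=> x dx; rewrite ballE (_ : [set j | _] = set0) ?image_set0 ?ereal_inf0//.
    apply/seteqP; split=> // j jx; apply: dx.
    by apply: (coord_ball_mono normN) jx; rewrite -ltnS.
  split; first by rewrite Lball ballE.
  split; first exact: Lsphere.
  split; first by rewrite Lsphere; exact: largest_closed_convex_below_biconj.
  by rewrite Lsphere sphereE.
- exact: closed_proper.
- move=> phi_ge0 phi0 L; have [Lprop Lmin] := closed_proper phi.
  split; first exact: Lprop.
  split=> [x|x x0].
    by split; [exact: is_min_sphere|exact: is_min_norm_decomp].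
  have Nx := is_norm_gt0 normN x0.
  exists ((N x)%:E * L ((N x)^-1 *: x))%E; split.
    by apply: is_min_norm_decomp_scale => //; exact: is_min_norm_decomp.
  by rewrite capra_biconj_normalize// muleA -EFinM mulVf ?gt_eqF// mul1e.
Qed.
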